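(* Let $$\widehat{\boldsymbol\mu}^{\mathrm{CM}}(\mathbf t)=\mathbf y+\mathbf Q^{-1}\mathbf W(\mathbf W'\mathbf Q^{-1}\mathbf W)^{-1}\{\mathbf t(\mathbf y)-\mathbf W'\mathbf y\}$$ be the constrained generalized Bayes estimator for the uniform prior. Then, with respect to the risk $R$: (1) $\widehat{\boldsymbol\mu}^{\mathrm{CM}}(\mathbf t)$ is minimax within $\Gamma_C$ provided that $$R_2(\boldsymbol\mu,\mathbf t)=E[(\mathbf t(\mathbf y)-\mathbf W'\boldsymbol\mu)'(\mathbf W'\mathbf Q^{-1}\mathbf W)^{-1}(\mathbf t(\mathbf y)-\mathbf W'\boldsymbol\mu)\,|\,\boldsymbol\mu]$$ does not depend on the unknown $\boldsymbol\mu$. (2) $\widehat{\boldsymbol\mu}^{\mathrm{CM}}(\mathbf t)$ is admissible within $\Gamma_C$ when $k-m$ is one or two. (3) $\widehat{\boldsymbol\mu}^{\mathrm{CM}}(\mathbf t)$ is inadmissible within $\Gamma_C$ when $k-m\ge 3$.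
   Context: Model: $\mathbf y\,|\,\boldsymbol\mu\sim\mathcal N_k(\boldsymbol\mu,\mathbf D)$ with $\boldsymbol\mu\in\mathbb R^k$ unknown and $\mathbf D=\mathrm{diag}(d_1,\dots,d_k)$ known, $d_i>0$. $\mathbf Q$ is a fixed $k\times k$ (symmetric) positive definite matrix; $\mathbf W$ is a fixed $k\times m$ matrix of rank $m$, $m<k$; $\mathbf t=\mathbf t(\mathbf y)$ is a given function from $\mathbb R^k$ to $\mathbb R^m$ with finite second moments given $\boldsymbol\mu$. $\Gamma$ is the class of estimators $\widehat{\boldsymbol\mu}=\widehat{\boldsymbol\mu}(\mathbf y)$ with $E[\widehat{\boldsymbol\mu}'\widehat{\boldsymbol\mu}\,|\,\boldsymbol\mu]<\infty$; the risk is $R(\boldsymbol\mu,\widehat{\boldsymbol\mu})=E[(\widehat{\boldsymbol\mu}-\boldsymbol\mu)'\mathbf Q(\widehat{\boldsymbol\mu}-\boldsymbol\mu)\,|\,\boldsymbol\mu]$. For $\widehat{\boldsymbol\mu}\in\Gamma$, $$\widehat{\boldsymbol\mu}^{C}(\widehat{\boldsymbol\mu},\mathbf t)=\widehat{\boldsymbol\mu}+\mathbf Q^{-1}\mathbf W(\mathbf W'\mathbf Q^{-1}\mathbf W)^{-1}\{\mathbf t(\mathbf y)-\mathbf W'\widehat{\boldsymbol\mu}\},$$ and $\Gamma_C=\{\widehat{\boldsymbol\mu}^{C}(\widehat{\boldsymbol\mu},\mathbf t)\,|\,\widehat{\boldsymbol\mu}\in\Gamma\}$. An estimator in a class is admissible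 within it if no estimator of the class has risk no larger for all $\boldsymbol\mu$ and strictly smaller for some $\boldsymbol\mu$ (inadmissible otherwise); it is minimax within the class if its supremum risk over $\boldsymbol\mu$ equals the infimum over the class of the supremum risks. *)

(* Defs.v *)
From HB Require Import structures.
From mathcomp Require Import all_boot all_order all_algebra.
From mathcomp Require Import all_classical all_reals all_analysis.

Set Implicit Arguments.
Unset Strict Implicit.
Unset Printing Implicit Defensive.

Import Order.TTheory GRing.Theory Num.Theory.
Import numFieldNormedType.Exports.

Local Open Scope classical_set_scope.
Local Open Scope ring_scope.

(* ['cV[R]_n] with the product sigma-algebra, generated by the n coordinate
   maps; same construction as the library's instance on [n.-tuple T]. *)
Definition measure_cV_display : measure_display.
Proof. exact. Qed.

Section measurable_cV.
Context {R : realType} {n : nat}.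

Let coors : 'I_n -> 'cV[R]_n -> measurableTypeR R := fun i v => v i 0.

Let cV_set0 : g_sigma_preimage coors set0.
Proof. exact: sigma_algebra0. Qed.

Let cV_setC A : g_sigma_preimage coors A -> g_sigma_preimage coors (~` A).
Proof. exact: sigma_algebraC. Qed.

Let cV_bigcup (F : _^nat) : (forall i, g_sigma_preimage coors (F i)) ->
  g_sigma_preimage coors (\bigcup_i (F i)).
Proof. exact: sigma_algebra_bigcup. Qed.

HB.instance Definition _ := @isMeasurable.Build measure_cV_display
  'cV[R]_n (g_sigma_preimage coors) cV_set0 cV_setC cV_bigcup.

Lemma measurable_coor (i : 'I_n) :
  measurable_fun [set: 'cV[R]_n] (fun v : 'cV[R]_n => v i 0 : measurableTypeR R).
Proof.
move=> _ Y mY; rewrite setTI; apply: sub_sigma_algebra => /=.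
rewrite -bigcup_seq/=; exists i => /=; first by rewrite mem_index_enum.
by exists Y => //; rewrite setTI.
Qed.

End measurable_cV.

Lemma measurable_fun_cVP d (T : measurableType d) (R : realType) n
    (f : T -> 'cV[R]_n) :
  measurable_fun [set: T] f <->
  forall i, measurable_fun [set: T] (fun x => f x i 0 : measurableTypeR R).
Proof.
split=> [mf i|mf].
  exact: (measurableT_comp (measurable_coor i) mf).
move=> _ A mA; rewrite setTI; move: A mA.
have sS : sigma_algebra setT [set A : set 'cV[R]_n | measurable (f @^-1` A)].
  split => /=.
  - by rewrite preimage_set0; exact: measurable0.
  - by move=> A mA; rewrite setTD preimage_setC; exact: measurableC.
  - by move=> F mF; rewrite preimage_bigcup; exact: bigcup_measurable.
apply: smallest_sub => //.
move=> A /=; rewrite -bigcup_seq/= => -[i _ [B mB <-]].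
have := mf i measurableT B mB; rewrite !setTI; exact.
Qed.

Definition cV_cons (R : realType) n (x : measurableTypeR R * 'cV[R]_n) :
  'cV[R]_n.+1 := col_mx x.1%:M x.2.

Section cV_cons.
Context (R : realType) (n : nat).

Lemma cV_cons0 (x : measurableTypeR R * 'cV[R]_n) : cV_cons x ord0 0 = x.1.
Proof.
rewrite /cV_cons mxE; case: splitP => j //= _.
by rewrite mxE [j]ord1 eqxx mulr1n.
Qed.

Lemma cV_consS (x : measurableTypeR R * 'cV[R]_n) (i : 'I_n) :
  cV_cons x (lift ord0 i) 0 = x.2 i 0.
Proof.
rewrite /cV_cons mxE; case: splitP => j /=; rewrite /bump leq0n add1n.
  by rewrite [j]ord1.
by move=> /eqP; rewrite add1n eqSS => /eqP/val_inj ->.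
Qed.

Lemma measurable_cV_cons : measurable_fun setT (@cV_cons R n).
Proof.
apply/measurable_fun_cVP => i; have [j ->|->] := unliftP ord0 i.
- rewrite (_ : (fun x => _) = (fun v : 'cV[R]_n => v j 0) \o snd).
    exact: measurableT_comp (measurable_coor j) measurable_snd.
  by apply/funext => x /=; rewrite cV_consS.
- rewrite (_ : (fun x => _) = fst); first exact: measurable_fst.
  by apply/funext => x /=; rewrite cV_cons0.
Qed.

HB.instance Definition _ :=
  isMeasurableFun.Build _ _ _ _ (@cV_cons R n) measurable_cV_cons.

End cV_cons.

(* The product of n probability measures on the real line. *)
Fixpoint cV_prod_law (R : realType) n :
    ('I_n -> probability (measurableTypeR R) R) -> probability 'cV[R]_n R :=
  match n with
  | 0 => fun=> \d_(0 : 'cV[R]_0)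
  | n'.+1 => fun P =>
      distribution (P ord0 \x cV_prod_law (fun i => P (lift ord0 i)))%E
        (@cV_cons R n')
  end.

Lemma cV_prod_lawE (R : realType) n
    (P : 'I_n -> probability (measurableTypeR R) R)
    (A : 'I_n -> set (measurableTypeR R)) : (forall i, measurable (A i)) ->
  cV_prod_law P [set v | forall i, A i (v i 0)] = (\prod_i P i (A i))%E.
Proof.
elim: n => [|n IH] in P A *=> mA.
  rewrite big_ord0 /= diracE mem_set//=; by case.
rewrite big_ord_recl /=.
rewrite /distribution /pushforward/=.
rewrite (_ : _ @^-1` _ = A ord0 `*`
    [set v : 'cV[R]_n | forall i, A (lift ord0 i) (v i 0)]).
  have mB : measurable [set v : 'cV[R]_n | forall i, A (lift ord0 i) (v i 0)].
    rewrite (_ : [set v | _] = \bigcap_(i in [set: 'I_n])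
       ((fun v : 'cV[R]_n => v i 0 : measurableTypeR R) @^-1` A (lift ord0 i))).
      apply: fin_bigcap_measurable => // i _.
      by rewrite -[X in measurable X]setTI; exact: measurable_coor.
    by apply/seteqP; split=> v /= h i; [move=> _|]; exact: h.
  rewrite product_measure1E//; congr (_ * _)%E.
  exact: (IH (fun i => P (lift ord0 i)) (fun i => A (lift ord0 i))).
apply/seteqP; split=> -[a v] /=.
  move=> h; split; first by have := h ord0; rewrite cV_cons0.
  by move=> i; have := h (lift ord0 i); rewrite cV_consS.
move=> [h0 h] i; have [j ->|->] := unliftP ord0 i.
  by rewrite cV_consS; exact: h.
by rewrite cV_cons0.
Qed.

(* The normal distribution N_k(mu, diag_mx d): independent coordinates, the
   i-th one with mean [mu i 0] and variance [d 0 i]; the second argument of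
   [normal_prob] is the standard deviation. *)
Definition diag_normal (R : realType) k (d : 'rV[R]_k) (mu : 'cV[R]_k) :
    probability 'cV[R]_k R :=
  cV_prod_law (fun i => normal_prob (mu i 0) (Num.sqrt (d 0 i))).

Definition qform (R : realType) n (A : 'M[R]_n) (v : 'cV[R]_n) : R :=
  (v^T *m A *m v) 0 0.

Definition posdefmx (R : realType) n (A : 'M[R]_n) : Prop :=
  A^T = A /\ forall v : 'cV[R]_n, v != 0 -> 0 < qform A v.

Section estimation.
Context {R : realType} {k m : nat}.
Implicit Types (d : 'rV[R]_k) (mu : 'cV[R]_k) (Q : 'M[R]_k) (W : 'M[R]_(k, m))
  (t : 'cV[R]_k -> 'cV[R]_m) (delta : 'cV[R]_k -> 'cV[R]_k)
  (C : set ('cV[R]_k -> 'cV[R]_k)).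

Definition finite_second_moments n d (f : 'cV[R]_k -> 'cV[R]_n) : Prop :=
  forall mu, (\int[diag_normal d mu]_y (((f y)^T *m f y) 0 0)%:E < +oo)%E.

Definition estimators d : set ('cV[R]_k -> 'cV[R]_k) :=
  [set delta | measurable_fun setT delta /\ finite_second_moments d delta].

Definition risk d Q mu delta : \bar R :=
  (\int[diag_normal d mu]_y (qform Q (delta y - mu))%:E)%E.

Definition constrained Q W t delta : 'cV[R]_k -> 'cV[R]_k :=
  fun y => delta y + invmx Q *m W *m invmx (W^T *m invmx Q *m W)
                       *m (t y - W^T *m delta y).

Definition constrained_estimators d Q W t : set ('cV[R]_k -> 'cV[R]_k) :=
  constrained Q W t @` estimators d.

Definition muCM Q W t : 'cV[R]_k -> 'cV[R]_k := constrained Q W t id.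

Definition risk2 d Q W t mu : \bar R :=
  (\int[diag_normal d mu]_y
     (qform (invmx (W^T *m invmx Q *m W)) (t y - W^T *m mu))%:E)%E.

Definition dominates d Q delta' delta : Prop :=
  (forall mu, (risk d Q mu delta' <= risk d Q mu delta)%E) /\
  (exists mu, (risk d Q mu delta' < risk d Q mu delta)%E).

Definition admissible d Q C delta : Prop :=
  C delta /\ ~ exists2 delta', C delta' & dominates d Q delta' delta.

Definition inadmissible d Q C delta : Prop :=
  C delta /\ ~ admissible d Q C delta.

Definition sup_risk d Q delta : \bar R :=
  ereal_sup [set risk d Q mu delta | mu in setT].

Definition minimax d Q C delta : Prop :=
  C delta /\ sup_risk d Q delta = ereal_inf [set sup_risk d Q x | x in C].

End estimation.

(* Main.v *)
Require Import Defs.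
From HB Require Import structures.
From mathcomp Require Import all_boot all_order all_algebra.
From mathcomp Require Import all_classical all_reals all_analysis.
From mathcomp Require Import measurable_realfun ring lra.

Set Implicit Arguments.
Unset Strict Implicit.
Unset Printing Implicit Defensive.

Import Order.TTheory GRing.Theory Num.Theory.
Import numFieldNormedType.Exports.

(** The constraint splits the risk.  With V = (W^T Q^-1 W)^-1, the error of
    the constrained version of delta decomposes orthogonally for Q, so its risk
    is the risk of delta for the loss matrix M = Q - W V W^T plus R_2(mu, t)
    (risk_constrained).  The second term is finite and the same for every
    estimator of the class.  All three claims are therefore claims about the
    unconstrained estimator y for the positive semidefinite loss M, which has
    rank k - m (rank_projected_loss): the classical picture for the mean of a
    normal vector in dimension k - m.

    For the two positive claims, write M = A^T A with A having n rows.  If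
    delta has risk at most that of y, minus a constant eps >= 0, then
    f(y) = A (delta(y) - y) satisfies
      E [ |f|^2 + 2 f . A (y - mu) + eps ] <= 0  for every mu.
    Restrict mu to the slice mu = D A^T th, th in R^n: there A (y - mu) is the
    gradient in th of the log-likelihood.  Integrating the inequality against a
    centred Gaussian weight pi(th) and integrating by parts in th replaces
    A (y - mu) by - grad log pi, which is a multiple of th
    (bayes_inequality).

    Minimaxity: complete the square.  This leaves eps <= E_pi |grad log pi|^2,
    which is of order 1/S for a Gaussian weight of variance S, so that eps = 0
    (uniform_gain_le0).

    Admissibility when k - m <= 2: take eps = 0 and n = 2.  In the plane there
    are functions u with int |grad u|^2 arbitrarily small and u >= 1/2 near the
    origin, so Blyth's method applied with pi = u^2 forces f = 0.  Here u is an
    average of N Gaussians with variances 1, N, ..., N^(N-1); it makes the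
    weight pi a finite sum of Gaussian weights, and its energy is O(1/N)
    (blyth_bound).  Hence f = 0 almost everywhere (dominating_gap_eq0), and
    delta has the same risk as y.

    Inadmissibility when k - m >= 3: y is dominated by a James-Stein estimator
    adapted to D and to the degenerate loss M,
      y - K y / (q(y) + 1),   q(y) = (K y)^T M (K y),
    where K is a reflexive generalized inverse of D M.  Adding 1 to the
    denominator makes the vector field smooth and bounded, so Stein's identity
    applies directly; the change of risk is the expectation of a strictly
    negative function (shrink_strict_improvement). *)

Local Open Scope classical_set_scope.
Local Open Scope ring_scope.

(** * Quadratic forms *)
Section quadratic_forms.
Context {R : realType}.

Definition dot n (u v : 'cV[R]_n) : R := \sum_i u i 0 * v i 0.

Definition psdmx n (A : 'M[R]_n) : Prop :=
  A^T = A /\ forall v : 'cV[R]_n, 0 <= qform A v.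

Lemma dotE n (u v : 'cV[R]_n) : dot u v = (u^T *m v) 0 0.
Proof. by rewrite mxE; apply: eq_bigr => i _; rewrite mxE. Qed.

Lemma dotC n (u v : 'cV[R]_n) : dot u v = dot v u.
Proof. by apply: eq_bigr => i _; rewrite mulrC. Qed.

Lemma dotDl n (u v w : 'cV[R]_n) : dot (u + v) w = dot u w + dot v w.
Proof. by rewrite !dotE linearD mulmxDl mxE. Qed.

Lemma dotNl n (u w : 'cV[R]_n) : dot (- u) w = - dot u w.
Proof. by rewrite !dotE linearN mulNmx mxE. Qed.

Lemma dotZl n a (u w : 'cV[R]_n) : dot (a *: u) w = a * dot u w.
Proof. by rewrite !dotE linearZ -scalemxAl mxE. Qed.

Lemma dotDr n (u v w : 'cV[R]_n) : dot w (u + v) = dot w u + dot w v.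
Proof. by rewrite dotC dotDl !(dotC w). Qed.

Lemma dotNr n (u w : 'cV[R]_n) : dot w (- u) = - dot w u.
Proof. by rewrite dotC dotNl (dotC w). Qed.

Lemma dotZr n a (u w : 'cV[R]_n) : dot w (a *: u) = a * dot w u.
Proof. by rewrite dotC dotZl (dotC w). Qed.

Lemma dot_mul n p (A : 'M[R]_(p, n)) (u : 'cV[R]_p) (v : 'cV[R]_n) :
  dot u (A *m v) = dot (A^T *m u) v.
Proof. by rewrite !dotE trmx_mul trmxK mulmxA. Qed.

Lemma dot_ge0 n (u : 'cV[R]_n) : 0 <= dot u u.
Proof. by apply: sumr_ge0 => i _; rewrite -expr2 sqr_ge0. Qed.

Lemma coor_sqr_le n (u : 'cV[R]_n) i : u i 0 ^+ 2 <= dot u u.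
Proof.
rewrite /dot (bigD1 i)//= -expr2 lerDl; apply: sumr_ge0 => j _.
by rewrite -expr2 sqr_ge0.
Qed.

Lemma dotD_le n (u v : 'cV[R]_n) : dot (u + v) (u + v) <= 2 * dot u u + 2 * dot v v.
Proof.
have := dot_ge0 (u - v); rewrite !(dotDl, dotDr, dotNl, dotNr) (dotC v u); lra.
Qed.
Lemma dot_eq0 n (u : 'cV[R]_n) : dot u u = 0 -> u = 0.
Proof.
move=> /eqP; rewrite psumr_eq0; last by move=> i _; rewrite -expr2 sqr_ge0.
move=> /allP h; apply/matrixP => i j; rewrite [j]ord1 mxE.
by have /eqP := h i (mem_index_enum _); move=> /eqP; rewrite /= mulf_eq0 orbb => /eqP.
Qed.

Lemma qformE n (A : 'M[R]_n) (v : 'cV[R]_n) : qform A v = dot v (A *m v).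
Proof. by rewrite /qform dotE mulmxA. Qed.

Lemma qformD n (A : 'M[R]_n) (u v : 'cV[R]_n) : A^T = A ->
  qform A (u + v) = qform A u + 2 * dot v (A *m u) + qform A v.
Proof.
move=> sA; rewrite !qformE mulmxDr !(dotDl, dotDr).
have -> : dot u (A *m v) = dot v (A *m u) by rewrite dot_mul sA dotC.
ring.
Qed.

Lemma qformZ n (A : 'M[R]_n) a (v : 'cV[R]_n) : qform A (a *: v) = a ^+ 2 * qform A v.
Proof. by rewrite !qformE -scalemxAr dotZl dotZr; ring. Qed.

Lemma qform_gram n p (A : 'M[R]_(p, n)) (v : 'cV[R]_n) :
  qform (A^T *m A) v = dot (A *m v) (A *m v).
Proof. by rewrite qformE -mulmxA dot_mul trmxK. Qed.

Lemma qform_le n (A : 'M[R]_n) : exists2 C, 0 <= C & forall v, `|qform A v| <= C * dot v v.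
Proof.
exists (\sum_i \sum_j `|A i j|).
  by apply: sumr_ge0 => i _; apply: sumr_ge0 => j _.
move=> v; rewrite qformE /dot mulr_suml; apply: le_trans (ler_norm_sum _ _ _) _.
apply: ler_sum => i _; rewrite mxE mulr_sumr mulr_suml.
apply: le_trans (ler_norm_sum _ _ _) _; apply: ler_sum => j _.
rewrite mulrCA normrM ler_wpM2l//.
have hi l : v l 0 ^+ 2 <= \sum_i v i 0 * v i 0 := coor_sqr_le v l.
have := hi i; have := hi j; move: (v i 0) (v j 0) (\sum_ _ _) => x y s hy hx.
have hp := sqr_ge0 (x + y); have hm := sqr_ge0 (x - y).
by rewrite ler_norml; apply/andP; split; nra.
Qed.

(** Cauchy-Schwarz for a degenerate form: the polynomial qform A (v + a u) in a
    is nonnegative.  When its leading coefficient vanishes it is affine, so its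
    slope must vanish too. *)
Lemma psd_cauchy n (A : 'M[R]_n) u v : psdmx A ->
  dot u (A *m v) ^+ 2 <= qform A u * qform A v.
Proof.
move=> [sA pA].
have H a : 0 <= qform A v + 2 * a * dot u (A *m v) + a ^+ 2 * qform A u.
  have := pA (v + a *: u); rewrite qformD// qformZ dotZl; lra.
have := pA u; have := pA v; move: (qform A u) (qform A v) (dot _ _) H => x y z H y0 x0.
have [xE|x1] := eqVneq x 0.
  rewrite xE; have [->|z1] := eqVneq z 0; first by rewrite expr0n mul0r.
  (* if the slope 2 z were nonzero, the affine function would be -1 here *)
  have := H (- (y + 1) / (2 * z)); rewrite xE mulr0 addr0.
  have -> : y + 2 * (- (y + 1) / (2 * z)) * z = - 1 by field.
  by rewrite lerNr oppr0 ler10.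
have x2 : 0 < x by rewrite lt_def x1.
have := H (- z / x).
have -> : y + 2 * (- z / x) * z + (- z / x) ^+ 2 * x = (y * x - z ^+ 2) / x by field.
by rewrite pmulr_lge0 ?invr_gt0// subr_ge0 mulrC.
Qed.

Lemma psd_ker n (A : 'M[R]_n) v : psdmx A -> qform A v = 0 -> A *m v = 0.
Proof.
move=> pA v0; apply: dot_eq0; apply/eqP; rewrite -[_ == 0]orbb -mulf_eq0 -expr2.
by rewrite eq_le sqr_ge0 andbT (le_trans (psd_cauchy _ _ pA))// v0 mulr0.
Qed.

Lemma posdef_psd n (A : 'M[R]_n) : posdefmx A -> psdmx A.
Proof.
move=> [sA pA]; split=> // v; have [->|v0] := eqVneq v 0; last exact/ltW/pA.
by rewrite qformE mulmx0 dotE mulmx0 mxE.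
Qed.

Lemma mulmx_inj_unit n (A : 'M[R]_n) :
  (forall v : 'cV[R]_n, A *m v = 0 -> v = 0) -> A \in unitmx.
Proof.
move=> h; rewrite -unitmx_tr -row_free_unit; apply: inj_row_free => v v0.
by apply: trmx_inj; rewrite trmx0; apply: h; rewrite -[A]trmxK -trmx_mul v0 trmx0.
Qed.

Lemma posdef_unit n (A : 'M[R]_n) : posdefmx A -> A \in unitmx.
Proof.
move=> [sA pA]; apply: mulmx_inj_unit => v v0; apply/eqP/negP => /negP/pA.
by rewrite qformE v0 dotE mulmx0 mxE ltxx.
Qed.

Lemma posdef_inv n (A : 'M[R]_n) : posdefmx A -> posdefmx (invmx A).
Proof.
move=> pA; have uA := posdef_unit pA; case: pA => sA pA; split; first by rewrite trmx_inv sA.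
move=> v v0.
have -> : qform (invmx A) v = qform A (invmx A *m v) by rewrite !qformE mulKVmx// dotC.
apply: pA.
by apply: contra_neq v0 => /(congr1 (mulmx A)); rewrite mulKVmx// mulmx0.
Qed.

Lemma posdef_congr n p (A : 'M[R]_n) (W : 'M[R]_(n, p)) :
  posdefmx A -> \rank W = p -> posdefmx (W^T *m A *m W).
Proof.
move=> [sA pA] rW; split; first by rewrite !trmx_mul trmxK sA mulmxA.
move=> v v0; rewrite qformE -!mulmxA dot_mul trmxK -qformE; apply: pA.
apply: contra_neq v0 => /(congr1 trmx); rewrite trmx_mul trmx0 => /eqP.
have fW : row_free W^T by rewrite /row_free mxrank_tr rW.
by rewrite mulmx_free_eq0// => /eqP vT; apply: trmx_inj; rewrite vT trmx0.
Qed.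

(** A symmetric rank-one update lowers the rank: if v^T M v > 0 and
    w = M v / sqrt (v^T M v), then M - w w^T is still positive semidefinite by
    Cauchy-Schwarz and kills v, which M does not.  The vectors w collected this
    way are the rows of A.  Allowing p to exceed the rank pads A with zero
    rows, so that a factor with two rows exists for any rank at most two. *)
Lemma psd_factor n p (M : 'M[R]_n) : psdmx M -> (\rank M <= p)%N ->
  exists A : 'M[R]_(p, n), M = A^T *m A.
Proof.
elim: p M => [|p IH] M pM; have [sM qM] := pM.
  rewrite leqn0 mxrank_eq0 => /eqP ->; exists 0; by rewrite mulmx0.
move=> rM; have [M0|M0] := eqVneq M 0.
  by exists 0; rewrite mulmx0.
have [v v0] : exists v, qform M v != 0.
  apply: contrapT => /forallNP h; move/eqP: M0; apply; apply/matrixP => i j.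
  have : M *m delta_mx j (0 : 'I_1) = 0.
    by apply: psd_ker => //; apply/eqP/negPn/negP; exact: h.
  by rewrite -colE => /matrixP/(_ i 0); rewrite !mxE.
have vp : 0 < qform M v by rewrite lt_def v0 qM.
pose w := (Num.sqrt (qform M v))^-1 *: (M *m v).
have sq2 : (Num.sqrt (qform M v))^-1 ^+ 2 = (qform M v)^-1 by rewrite exprVn sqr_sqrtr// ltW.
pose N := M - w *m w^T.
have NE u : qform N u = qform M u - dot u (M *m v) ^+ 2 / qform M v.
  rewrite (qformE N) mulmxBl dotDr dotNr -mulmxA (dot_mul w) -qformE; congr (_ - _).
  have -> : dot (w^T *m u) (w^T *m u) = dot u w ^+ 2.
    by rewrite /dot big_ord1 !mxE -expr2; congr (_ ^+ 2); apply: eq_bigr => i _; rewrite !mxE mulrC.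
  by rewrite /w dotZr exprMn sq2 mulrC.
have pN : psdmx N.
  split; first by rewrite linearB /= trmx_mul trmxK sM.
  move=> u; rewrite NE subr_ge0 ler_pdivrMr//; exact: psd_cauchy.
have Nv : N *m v = 0.
  apply: psd_ker => //; rewrite NE -qformE; field; exact: v0.
have Nsub : (N <= M)%MS.
  apply/row_subP => i; rewrite linearB /= row_mul; apply: addmx_sub; first exact: row_sub.
  rewrite -mulNmx mulmx_sub// /w linearZ /= trmx_mul sM.
  by rewrite scalemx_sub// submxMl.
have rN : (\rank N <= p)%N.
  rewrite -ltnS (leq_trans _ rM)// ltn_neqAle mxrankS// andbT.
  apply/negP => rNM; have : (M <= N)%MS by have := mxrank_leqif_sup Nsub => -[_ <-].
  move=> /submxP [X MX]; move: v0; rewrite qformE MX -mulmxA Nv mulmx0 dotE mulmx0 mxE.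
  by rewrite eqxx.
have [A NA] := IH N pN rN.
exists (col_mx w^T A : 'M[R]_(1 + p, n)).
by rewrite (tr_col_mx w^T A) (mul_row_col w^T^T) trmxK -NA /N addrC subrK.
Qed.

(** From a full-rank factorization X = c b, the product of a right inverse of b
    and a left inverse of c.  X K is a projection, so its trace is its rank. *)
Lemma reflexive_inverse n (X : 'M[R]_n) :
  exists K : 'M[R]_n, K *m X *m K = K /\ \tr (X *m K) = (\rank X)%:R.
Proof.
have [B] := row_freeP (row_base_free X).
have [C] := row_fullP (col_base_full X).
move: (mulmx_base X) C B; move: (col_base X) (row_base X).
move: (\rank X) => r c b <- C B hC hB; exists (B *m C); split.
  by rewrite !mulmxA -(mulmxA B C c) hC mulmx1 -(mulmxA B b B) hB mulmx1.
by rewrite -mulmxA (mulmxA b) hB mul1mx mxtrace_mulC hC mxtrace1.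
Qed.

End quadratic_forms.

(** * The loss left free by the constraint *)
Section projected_loss.
Context {R : realType} {k m : nat}.
Variables (Q : 'M[R]_k) (W : 'M[R]_(k, m)).

(** The form x |-> x^T Q x minimized over the fibre x + Im (Q^-1 W): what
    remains of the loss when the error in the direction of the constraint is
    adjusted optimally. *)
Definition projected_loss : 'M[R]_k :=
  Q - W *m invmx (W^T *m invmx Q *m W) *m W^T.

Hypotheses (posQ : posdefmx Q) (rankW : \rank W = m).

Local Notation V := (invmx (W^T *m invmx Q *m W)).
Local Notation J := (invmx Q *m W *m V).

Let uQ : Q \in unitmx := posdef_unit posQ.
Let pV : posdefmx V := posdef_inv (posdef_congr (posdef_inv posQ) rankW).
Let uV : W^T *m invmx Q *m W \in unitmx :=
  posdef_unit (posdef_congr (posdef_inv posQ) rankW).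

Let WJ : W^T *m J = 1%:M.
Proof. by rewrite !mulmxA mulmxV. Qed.

Let QJ : Q *m J = W *m V.
Proof. by rewrite -(mulmxA (invmx Q) W) mulKVmx. Qed.

Let MJ : projected_loss = Q *m (1%:M - J *m W^T).
Proof. by rewrite mulmxBr mulmx1 mulmxA QJ. Qed.

(** Pythagoras for Q: with J = Q^-1 W V, the vector x - J W^T x is Q-orthogonal
    to the range of J, and J s has squared length qform V s. *)
Lemma qform_constrained (x : 'cV[R]_k) (s : 'cV[R]_m) :
  qform Q (x + J *m (s - W^T *m x)) = qform projected_loss x + qform V s.
Proof.
have sQ := posQ.1; have [sV _] := pV.
have tWJ : J^T *m W = 1%:M.
  by have := congr1 trmx WJ; rewrite trmx_mul trmxK trmx1.
have JQ : J^T *m Q = V *m W^T.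
  by have := congr1 trmx QJ; rewrite [RHS]trmx_mul sV trmx_mul sQ.
have QJ' := QJ; set j := J in tWJ JQ QJ' *.
clearbody j.
rewrite qformD// !qformE !mulmxA QJ'.
set z := s - _.
have e1 : dot (j *m z) (Q *m x) = dot z (V *m (W^T *m x)).
  by rewrite -{1}[j]trmxK -dot_mul !mulmxA -JQ.
have e2 : dot (j *m z) (W *m V *m z) = dot z (V *m z).
  by rewrite -{1}[j]trmxK -dot_mul !mulmxA tWJ mul1mx.
have e3 : dot x (projected_loss *m x) = dot x (Q *m x) - dot (W^T *m x) (V *m (W^T *m x)).
  by rewrite mulmxBl dotDr dotNr -!mulmxA (dot_mul W).
rewrite e3 e1 e2 /z; move: (W^T *m x) => u.
have sy a b : dot a (V *m b) = dot b (V *m a) by rewrite dot_mul sV dotC.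
rewrite mulmxBr !(dotDl, dotDr, dotNl, dotNr) (sy s u); ring.
Qed.

(** The case s = 0 of the decomposition exhibits the form as a value of
    qform Q. *)
Lemma projected_loss_psd : psdmx projected_loss.
Proof.
have [sQ _] := posQ; have [sV _] := pV; split.
  by rewrite linearB /= !trmx_mul trmxK sQ sV mulmxA.
move=> x; have := qform_constrained x 0.
rewrite [qform V 0]qformE mulmx0 dotE mulmx0 mxE addr0 => <-.
exact: (posdef_psd posQ).2.
Qed.

(** Up to the unit Q, the matrix is the projection 1 - J W^T, whose kernel is
    the m-dimensional range of J. *)
Lemma rank_projected_loss : \rank projected_loss = (k - m)%N.
Proof.
have rJ : (m <= \rank J)%N.
  by rewrite -{1}(mxrank1 R m) -WJ mxrankM_maxr.
have mk : (m <= k)%N by rewrite -rankW rank_leq_row.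
apply/eqP; rewrite eqn_leq; apply/andP; split.
  have : projected_loss *m J = 0.
    by rewrite MJ -mulmxA mulmxBl mul1mx -(mulmxA J) WJ mulmx1 subrr mulmx0.
  move=> /mulmx0_rank_max /(leq_sub2r (\rank J)); rewrite addnK => /leq_trans; apply.
  exact: leq_sub2l.
rewrite leq_subLR.
have -> : \rank projected_loss = \rank (1%:M - J *m W^T).
  by rewrite MJ; apply: (eqmxMfull _ _).1; rewrite row_full_unit.
have := mxrank_add (J *m W^T) (1%:M - J *m W^T).
rewrite addrC subrK mxrank1 => /leq_trans; apply.
by rewrite leq_add2r (leq_trans (mxrankM_maxl _ _))// rank_leq_col.
Qed.

End projected_loss.

(** * Integrals and densities *)
Lemma le0_integral {R : realType} {d : measure_display} {T : measurableType d}
    (mu : {measure set T -> \bar R}) (g : T -> \bar R) :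
  (forall x, g x <= 0)%E -> (\int[mu]_x g x <= 0)%E.
Proof.
move=> g0; under eq_integral do rewrite -[g _]oppeK.
rewrite integral_ge0N; last by move=> x _; rewrite oppe_ge0.
by rewrite oppe_le0; apply: integral_ge0 => x _; rewrite oppe_ge0.
Qed.

Lemma prob_integral_cst {R : realType} {d : measure_display} {T : measurableType d}
    (P : probability T R) (c : \bar R) :
  (\int[P]__ c = c)%E.
Proof.
have -> : (\int[P]__ c = c * P setT)%E by exact: integral_cst.
by rewrite probability_setT mule1.
Qed.

Lemma prob_integral_eq0_ex {R : realType} {d : measure_display} {T : measurableType d}
    (P : probability T R) (g : T -> \bar R) :
  measurable_fun setT g -> (forall x, 0 <= g x)%E -> (\int[P]_x g x = 0)%E ->
  exists x, g x = 0%E.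
Proof.
move=> mg g0 ig; apply: contrapT => /forallNP ng.
have ig' : (\int[P]_x `|g x| = 0)%E.
  by rewrite -ig; apply: eq_integral => x _; rewrite gee0_abs.
have /iffLR/(_ ig') [N [mN N0 sub]] := ae_eq_integral_abs P measurableT mg.
have : (P setT <= P N)%E.
  apply: le_measure; rewrite ?inE// => x _; apply: sub => /= /(_ I); exact: ng.
by rewrite N0 probability_setT lee_fin ler10.
Qed.

Section density.
Local Open Scope ereal_scope.
Context d (T : measurableType d) (R : realType).

(** Stated through integrals of nonnegative functions, the only form in which
    densities are used, so that reweightings compose and pass to products by
    rewriting alone. *)
Definition has_density (nu mu : {measure set T -> \bar R}) (p : T -> R) : Prop :=
  forall g : T -> \bar R, measurable_fun setT g -> (forall x, 0 <= g x) ->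
  \int[nu]_x g x = \int[mu]_x (g x * (p x)%:E).

Context (nu mu : {measure set T -> \bar R}) (p : T -> R).
Hypotheses (p0 : forall x, (0 <= p x)%R) (nup : has_density nu mu p).

Lemma density_integral (g : T -> \bar R) : measurable_fun setT g ->
  \int[nu]_x g x = \int[mu]_x (g x * (p x)%:E).
Proof.
move=> mg; rewrite integralE [RHS]integralE.
rewrite !nup//; [|exact: measurable_funeneg|exact: measurable_funepos].
congr (_ - _); apply: eq_integral => x _.
  have /(congr1 (@^~ x)) := ge0_funeposM g (p0 x).
  by rewrite /= !funeposE (muleC _ (g x)) => ->; rewrite muleC.
have /(congr1 (@^~ x)) := ge0_funenegM g (p0 x).
by rewrite /= !funenegE (muleC _ (g x)) => ->; rewrite muleC.
Qed.

Lemma density_integrable (g : T -> \bar R) : measurable_fun setT p ->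
  measurable_fun setT g ->
  nu.-integrable setT g <-> mu.-integrable setT (fun x => g x * (p x)%:E).
Proof.
move=> mp mg.
have E : \int[nu]_x `|g x| = \int[mu]_x `|g x * (p x)%:E|.
  rewrite nup//; last exact: measurableT_comp.
  by apply: eq_integral => x _; rewrite abseM [X in _ = _ * X]gee0_abs// lee_fin.
split=> /integrableP[mg' h]; apply/integrableP; split => //.
- by apply: emeasurable_funM => //; exact/measurable_EFinP.
- by rewrite -E.
- by rewrite E.
Qed.

End density.

Section normal1.
Context {R : realType}.
Notation leb := (@lebesgue_measure R).
Implicit Types m s : R.

(** Change of variables holds for the Radon-Nikodym derivative, which agrees
    almost everywhere with the explicit density. *)
Lemma normal_density m s : has_density (normal_prob m s) leb (normal_pdf m s).
Proof.
move=> g mg g0.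
have dom := normal_prob_dominates m s.
rewrite -(Radon_Nikodym_SigmaFinite.change_of_variables dom g0 measurableT mg).
apply: ae_eq_integral => //.
- apply: emeasurable_funM => //.
  exact: measurable_int (Radon_Nikodym_SigmaFinite.f_integrable dom).
- apply: emeasurable_funM => //; apply/measurable_EFinP; exact: measurable_normal_pdf.
- apply: ae_eqe_mul2l; apply: integral_ae_eq => //.
  + exact: Radon_Nikodym_SigmaFinite.f_integrable.
  + by apply/measurable_EFinP; exact: measurable_normal_pdf.
  + by move=> E _ mE; rewrite -Radon_Nikodym_SigmaFinite.f_integral.
Qed.

Lemma normal_density_reweight m s m' s' (w : R -> R) : measurable_fun setT w ->
  (forall x, 0 <= w x) ->
  (forall x, normal_pdf m' s' x = w x * normal_pdf m s x) ->
  has_density (normal_prob m' s') (normal_prob m s) w.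
Proof.
move=> mw w0 h g mg g0; apply: etrans (normal_density m' s' mg g0) _.
apply/esym; apply: etrans (normal_density m s _ _) _.
- by apply: emeasurable_funM => //; exact/measurable_EFinP.
- by move=> x; rewrite mule_ge0// lee_fin.
- by apply: eq_integral => x _; rewrite h EFinM muleA.
Qed.

Lemma normal_density_mean m s : s != 0 ->
  has_density (normal_prob m s) (normal_prob 0 s)
    (fun x : R => expR ((m * x - m ^+ 2 / 2) / s ^+ 2)).
Proof.
move=> s0; apply: normal_density_reweight.
- apply: measurableT_comp => //; apply: measurable_funM => //.
  by apply: measurable_funB => //; exact: measurable_funM.
- by move=> x; exact: expR_ge0.
- move=> x; rewrite !normal_pdfE//= /normal_fun mulrCA -expRD; congr (_ * expR _).
  by field.
Qed.

(** Multiplying a centred normal density by exp (- kap x^2) adds 2 kap to the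
    inverse variance; the square root is the normalizing constant. *)
Lemma normal_density_variance v kap : 0 < v -> 0 <= kap ->
  has_density (normal_prob 0 (Num.sqrt (v / (1 + 2 * kap * v)))) (normal_prob 0 (Num.sqrt v))
    (fun x : R => Num.sqrt (1 + 2 * kap * v) * expR (- kap * x ^+ 2)).
Proof.
move=> v0 k0.
have c0 : 0 < 1 + 2 * kap * v by rewrite ltr_wpDr// !mulr_ge0// ltW.
have vc0 : 0 < v / (1 + 2 * kap * v) by rewrite divr_gt0.
apply: normal_density_reweight.
- apply: measurable_funM => //; apply: measurableT_comp => //.
  by apply: measurable_funM => //; exact: measurable_funX.
- by move=> x; rewrite mulr_ge0 ?expR_ge0.
- move=> x; rewrite !normal_pdfE; [|by rewrite gt_eqF ?sqrtr_gt0..].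
  rewrite /normal_fun /normal_peak !sqr_sqrtr ?ltW// mulrACA -expRD; congr (_ * expR _).
  + set c := 1 + _ in c0 vc0 *.
    have -> : v * pi *+ 2 = c * (v / c * pi *+ 2).
      by rewrite -!mulrnAr mulrA (mulrC c) divfK// gt_eqF.
    by rewrite (sqrtrM _ (ltW c0)) invfM mulrA mulfV ?mul1r// gt_eqF// sqrtr_gt0.
  + field; by rewrite !gt_eqF.
Qed.

End normal1.

(** * Stein's identity on the line *)
Section calculus.
Context {R : realType}.

Lemma is_derive_quadratic (a b c x : R) :
  is_derive x (1 : R) (fun y : R => a + b * y + c * y ^+ 2) (b + 2 * c * x).
Proof.
have := is_derive_poly (a%:P + b%:P * 'X + c%:P * 'X^2) x.
rewrite (_ : horner _ = (fun y : R => a + b * y + c * y ^+ 2)).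
  move/is_derive_eq; apply; rewrite !poly.derivE !hornerE. ring.
by apply/funext => y; rewrite !hornerE.
Qed.

Lemma is_derive_exp_quadratic (a b c x : R) :
  is_derive x (1 : R) (fun y : R => expR (a + b * y + c * y ^+ 2))
    ((b + 2 * c * x) * expR (a + b * x + c * x ^+ 2)).
Proof.
have := is_derive_quadratic a b c x => h.
rewrite (_ : (fun y => _) = expR \o (fun y : R => a + b * y + c * y ^+ 2))//.
apply: is_derive_eq; rewrite mulrC//.
Qed.

Lemma exp_quadratic_le (a b c : R) : c < 0 -> exists2 K, 0 <= K &
  forall x, expR (a + b * x + c * x ^+ 2) <= K.
Proof.
move=> c0; exists (expR (a - b ^+ 2 / (4 * c))); first exact: expR_ge0.
move=> x; rewrite ler_expR -subr_ge0.
have -> : a - b ^+ 2 / (4 * c) - (a + b * x + c * x ^+ 2) = - c * (x + b / (2 * c)) ^+ 2.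
  by field; rewrite lt_eqF.
by rewrite mulr_ge0 ?sqr_ge0// oppr_ge0 ltW.
Qed.
Lemma is_derive_continuous (f f' : R -> R) :
  (forall x, is_derive x (1 : R) f (f' x)) -> continuous f.
Proof. by move=> h x; apply/differentiable_continuous/derivable1_diffP; case: (h x). Qed.

(** The boundary terms of the fundamental theorem of calculus on
    [m - n, m + n] are O(1 / n^2); integrability lets n tend to infinity on the
    left-hand side. *)
Lemma is_derive_cvg0_integral (F f : R -> R) (m K : R) :
  (forall x, is_derive x (1 : R) F (f x)) -> continuous f ->
  lebesgue_measure.-integrable setT (EFin \o f) ->
  (forall x, `|F x| <= K / (1 + (x - m) ^+ 2)) ->
  (\int[lebesgue_measure]_x (f x)%:E = 0)%E.
Proof.
move=> dF cf intf FK.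
pose A n := `[m - n.+1%:R, m + n.+1%:R]%classic.
pose f_ n x := ((f x)%:E * (\1_(A n) x)%:E)%E.
have K0 : 0 <= K.
  by have := le_trans (normr_ge0 _) (FK m); rewrite subrr expr0n addr0 divr1.
have FTC n : (\int[lebesgue_measure]_x f_ n x = (F (m + n.+1%:R) - F (m - n.+1%:R))%:E)%E.
  have -> : (\int[lebesgue_measure]_x f_ n x = \int[lebesgue_measure]_(x in A n) (f x)%:E)%E.
    rewrite [RHS]integral_mkcond; apply: eq_integral => x _.
    by rewrite /f_ patchE indicE; case: ifP => /= _; rewrite ?mule1 ?mule0.
  rewrite EFinB; apply: continuous_FTC2.
  - by rewrite ltrBlDr -addrA ltrDl -mulr2n pmulrn_lgt0// ltr0n.
  - exact: continuous_subspaceT.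
  - have cF := is_derive_continuous dF.
    split; first by move=> x _; case: (dF x).
      by apply: cvg_at_right_filter; exact: cF.
    by apply: cvg_at_left_filter; exact: cF.
  - by move=> x _; rewrite derive1E; case: (dF x).
have mf : measurable_fun setT (EFin \o f) by exact: (measurable_int _ intf).
have mf_ n : measurable_fun setT (f_ n).
  apply: emeasurable_funM; first exact: mf.
  by apply/measurable_EFinP; apply: measurable_indic; exact: measurable_itv.
have cvf : {ae lebesgue_measure, forall x : measurableTypeR R,
    setT x -> f_ ^~ x @ \oo --> (EFin \o f) x}.
  apply/aeW => x _; apply: cvg_near_cst.
  near=> n.
  have xA : A n x.
    rewrite /A/= in_itv/= -ler_distl.
    apply: (@le_trans _ _ n%:R); last by rewrite ler_nat.
    by near: n; exact: nbhs_infty_ger.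
  by rewrite /f_ indicE mem_set// mule1.
have f_f : {ae lebesgue_measure, forall (x : measurableTypeR R) n,
    setT x -> (`|f_ n x| <= `|f x|%:E)%E}.
  apply/aeW => x n _; rewrite /f_ -EFinM/= lee_fin normrM indicE.
  by case: (_ \in _); rewrite ?normr1 ?normr0 ?mulr1 ?mulr0.
have [_ _ h1] := @dominated_convergence _ (measurableTypeR R) R lebesgue_measure
  setT measurableT f_ (EFin \o f) (fun x => `|f x|%:E) mf_ mf cvf
  (integrable_norm intf) f_f.
have h2 : (\int[lebesgue_measure]_x f_ n x @[n --> \oo] --> 0)%E.
  under eq_fun do rewrite FTC.
  apply: cvg_EFin; first by near=> n.
  apply/cvgr0Pnorm_le => //= e e0.
  near=> n.
  have B z : `|z| = n.+1%:R -> `|F (m + z)| <= K * n.+1%:R^-1.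
    move=> zE; apply: le_trans (FK _) _; rewrite (addrC m) addrK.
    have z2 : z ^+ 2 = n.+1%:R ^+ 2 by rewrite -zE real_normK ?num_real.
    rewrite z2 ler_wpM2l// lef_pV2 ?posrE ?ltr0n// ?ltr_wpDr ?sqr_ge0//.
    have : 1 <= n.+1%:R :> R by rewrite ler1n.
    by move: (n.+1%:R) => y y1; nra.
  apply: le_trans (ler_normB _ _) _.
  have n0 : 0 <= n.+1%:R :> R by [].
  have := B _ (ger0_norm n0).
  have := B (- n.+1%:R); rewrite normrN => /(_ (ger0_norm n0)) b1 b2.
  have : K * n.+1%:R^-1 <= e / 2.
    rewrite ler_pdivrMr ?ltr0n// -ler_pdivrMl ?divr_gt0//.
    apply: (@le_trans _ _ n%:R); last by rewrite ler_nat.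
    by near: n; exact: nbhs_infty_ger.
  by move=> b3; rewrite [leRHS]splitr; exact: lerD (le_trans b2 b3) (le_trans b1 b3).
transitivity (limn (fun n => \int[lebesgue_measure]_x f_ n x)%E).
  by apply/esym/cvg_lim.
by apply/cvg_lim.
Unshelve. all: by end_near. Qed.

End calculus.

Section stein1.
Context {R : realType}.
Implicit Types m s : R.

(** Polynomial growth is absorbed by doubling the standard deviation.  This
    makes functions of quadratic growth integrable, and bounds the boundary
    terms in the integration by parts. *)
Lemma normal_pdf_widen m s : s != 0 -> exists2 C, 0 <= C &
  forall x, (1 + (x - m) ^+ 2) * normal_pdf m s x <= C * normal_pdf m (2 * s) x.
Proof.
move=> s0; have s20 : 2 * s != 0 by rewrite mulf_neq0// pnatr_eq0.
have sp : 0 < s ^+ 2 by rewrite exprn_even_gt0.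
(* the difference of the exponents: 1 / (2 s^2) - 1 / (2 (2 s)^2) *)
pose a := 3 / (8 * s ^+ 2).
have a0 : 0 < a by rewrite divr_gt0// mulr_gt0.
have p1 := normal_peak_gt0 s0; have p2 := normal_peak_gt0 s20.
exists ((1 + a^-1) * (normal_peak s / normal_peak (2 * s))).
  by apply: mulr_ge0; [rewrite addr_ge0// invr_ge0 ltW|rewrite divr_ge0// ltW].
move=> x; rewrite !normal_pdfE// /normal_fun.
set u := (x - m) ^+ 2; have u0 : 0 <= u by rewrite sqr_ge0.
have -> : - u / (s ^+ 2 *+ 2) = - (a * u) + - u / ((2 * s) ^+ 2 *+ 2).
  by rewrite /a; field.
rewrite expRD.
have h : (1 + u) * expR (- (a * u)) <= 1 + a^-1.
  rewrite expRN ler_pdivrMr ?expR_gt0//.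
  apply: (@le_trans _ _ ((1 + a^-1) * (1 + a * u))); last first.
    by apply: ler_wpM2l; [rewrite addr_ge0// invr_ge0 ltW|exact: expR_ge1Dx].
  have -> : (1 + a^-1) * (1 + a * u) = (1 + u) + (a * u + a^-1).
    by field; rewrite gt_eqF.
  rewrite lerDl; apply: addr_ge0; last by rewrite invr_ge0; exact: ltW.
  by apply: mulr_ge0 => //; exact: ltW.
set e := expR (- u / _); have e0 : 0 <= e by exact: expR_ge0.
have -> : (1 + u) * (normal_peak s * (expR (- (a * u)) * e)) =
  ((1 + u) * expR (- (a * u))) * (normal_peak s * e) by ring.
have -> : (1 + a^-1) * (normal_peak s / normal_peak (2 * s)) * (normal_peak (2 * s) * e)
  = (1 + a^-1) * (normal_peak s * e) by field; rewrite gt_eqF//= gt_eqF.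
by rewrite ler_wpM2r// mulr_ge0// ltW.
Qed.

Lemma normal_integrable m s (g : R -> R) (C : R) : s != 0 ->
  measurable_fun setT g -> (forall x, `|g x| <= C * (1 + (x - m) ^+ 2)) ->
  (normal_prob m s).-integrable setT (EFin \o g).
Proof.
move=> s0 mg gC; have [K K0 hK] := normal_pdf_widen m s0.
have C0 : 0 <= C.
  by have := le_trans (normr_ge0 _) (gC m); rewrite subrr expr0n addr0 mulr1.
have mEg : measurable_fun setT (EFin \o g) by exact/measurable_EFinP.
apply: (iffRL (@density_integrable _ (measurableTypeR R) R _ _ _ (normal_pdf_ge0 m s)
  (normal_density m s) _ (measurable_normal_pdf m s) mEg)).
apply: (@le_integrable _ (measurableTypeR R) R lebesgue_measure setT measurableT _
   (fun x => (C * K)%:E * (normal_pdf m (2 * s) x)%:E)%E).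
- apply: emeasurable_funM; first exact/measurable_EFinP.
  by apply/measurable_EFinP; exact: measurable_normal_pdf.
- move=> x _; rewrite -!EFinM /= lee_fin normrM (ger0_norm (normal_pdf_ge0 _ _ _)).
  rewrite [leRHS]ger0_norm; last by rewrite mulr_ge0 ?normal_pdf_ge0// mulr_ge0.
  apply: le_trans (ler_wpM2r (normal_pdf_ge0 _ _ _) (gC x)) _.
  by rewrite -!mulrA ler_wpM2l.
- by apply: integrableZl => //; exact: integrable_normal_pdf.
Qed.

(** The integrand times the density is the derivative of - s^2 h p, where p is
    the density, and that function decays faster than 1 / (1 + (x - m)^2). *)
Lemma normal_stein m s (h h' : R -> R) (C : R) : s != 0 ->
  (forall x, is_derive x (1 : R) h (h' x)) -> continuous h' ->
  (forall x, `|h x| <= C * (1 + `|x - m|)) ->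
  (forall x, `|h' x| <= C * (1 + `|x - m|)) ->
  (\int[normal_prob m s]_x ((x - m) * h x - s ^+ 2 * h' x)%:E = 0)%E.
Proof.
move=> s0 dh ch' hC h'C.
have C0 : 0 <= C.
  by have := le_trans (normr_ge0 _) (hC m); rewrite subrr normr0 addr0 mulr1.
have ch : continuous h := is_derive_continuous dh.
have sp : 0 < s ^+ 2 by rewrite exprn_even_gt0.
have [K K0 hK] := normal_pdf_widen m s0.
have s20 : 2 * s != 0 by rewrite mulf_neq0// pnatr_eq0.
(* widened a second time: one factor 1 + (x - m)^2 pays for the growth of h,
   the other for the decay required of the boundary terms *)
have [K2 K20 hK2] := normal_pdf_widen m s20.
pose phi x := (x - m) * h x - s ^+ 2 * h' x.
have cphi : continuous phi.
  move=> x; apply: cvgB; last by apply: cvgM; [exact: cvg_cst|exact: ch'].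
  by apply: cvgM; [apply: cvgB; [exact: cvg_id|exact: cvg_cst]|exact: ch].
have mphi : measurable_fun setT phi by exact: continuous_measurable_fun.
have mEphi : measurable_fun setT (EFin \o phi) by exact/measurable_EFinP.
have sq x : `|x - m| ^+ 2 = (x - m) ^+ 2 by rewrite real_normK ?num_real.
have phiC x : `|phi x| <= (C * (2 + 2 * s ^+ 2)) * (1 + (x - m) ^+ 2).
  apply: le_trans (ler_normB _ _) _; rewrite (normrM (x - m)) (normrM (s ^+ 2)) (ger0_norm (ltW sp)) -sq.
  move: (hC x) (h'C x) (normr_ge0 (x - m)).
  move: `|h x| `|h' x| `|x - m| => y y' u h1 h2 u0.
  have e1 : u * y <= u * (C * (1 + u)) by rewrite ler_wpM2l.
  have e2 : s ^+ 2 * y' <= s ^+ 2 * (C * (1 + u)) by rewrite ler_wpM2l// ltW.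
  have e3 : (u + s ^+ 2) * (1 + u) <= (2 + 2 * s ^+ 2) * (1 + u ^+ 2).
    move: (s ^+ 2) sp => v v0; have := sqr_ge0 (u - 1).
    by move=> f1; have := mulr_ge0 (ltW v0) f1; have := mulr_ge0 (ltW v0) (sqr_ge0 u); nra.
  have := ler_wpM2l C0 e3; nra.
have intphi : (normal_prob m s).-integrable setT (EFin \o phi).
  exact: normal_integrable mphi phiC.
rewrite (@density_integral _ (measurableTypeR R) R _ _ _ (normal_pdf_ge0 m s) (normal_density m s)); last first.
  exact/measurable_EFinP.
have pE x : normal_pdf m s x = normal_peak s *
    expR (- m ^+ 2 / (2 * s ^+ 2) + m / s ^+ 2 * x + - (2 * s ^+ 2)^-1 * x ^+ 2).
  by rewrite normal_pdfE// /normal_fun; congr (_ * expR _); field.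
have dp x : is_derive x (1 : R) (normal_pdf m s) (- (x - m) / s ^+ 2 * normal_pdf m s x).
  rewrite pE (_ : normal_pdf m s = cst (normal_peak s) * (fun x =>
    expR (- m ^+ 2 / (2 * s ^+ 2) + m / s ^+ 2 * x + - (2 * s ^+ 2)^-1 * x ^+ 2))); last first.
    by apply/funext => y; rewrite pE.
  have h1 := is_derive_exp_quadratic (- m ^+ 2 / (2 * s ^+ 2)) (m / s ^+ 2) (- (2 * s ^+ 2)^-1) x.
  have h2 := is_derive_cst (normal_peak s) x (1 : R).
  apply: (is_derive_eq (is_deriveM h2 h1)).
  rewrite /GRing.scale /= mulr0 addr0.
  by field.
have dF x : is_derive x (1 : R) (fun y => - s ^+ 2 * (h y * normal_pdf m s y))
    (phi x * normal_pdf m s x).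
  have h1 := is_deriveM (dh x) (dp x).
  have h2 := is_deriveM (is_derive_cst (- s ^+ 2) x (1 : R)) h1.
  apply: (is_derive_eq h2); rewrite /GRing.scale /= mulr0 addr0 /phi.
  by field.
rewrite (_ : (\int[_]__ _)%E = (\int[lebesgue_measure]_x (phi x * normal_pdf m s x)%:E)%E)//.
apply: (is_derive_cvg0_integral (m := m) (K := s ^+ 2 * (C * 2 * (K * (K2 * normal_peak (2 * (2 * s)))))) dF).
- by move=> x; apply: cvgM; [exact: cphi|exact: continuous_normal_pdf].
- apply: eq_integrable; last first.
    exact: (iffLR (@density_integrable _ (measurableTypeR R) R _ _ _ (normal_pdf_ge0 m s)
      (normal_density m s) _ (measurable_normal_pdf m s) mEphi)).
  by move=> x _; rewrite /= EFinM.
  exact: measurableT.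
move=> x; rewrite mulNr normrN normrM (ger0_norm (ltW sp)) -(mulrA (s ^+ 2)).
apply: ler_wpM2l; first exact: ltW.
rewrite normrM (ger0_norm (normal_pdf_ge0 _ _ _)).
have u0 : 0 <= (x - m) ^+ 2 by exact: sqr_ge0.
rewrite ler_pdivlMr ?ltr_wpDr//.
have b1 : `|h x| <= C * 2 * (1 + (x - m) ^+ 2).
  apply: le_trans (hC x) _; rewrite -mulrA ler_wpM2l// -sq.
  by have := sqr_ge0 (`|x - m| - 1); have := normr_ge0 (x - m); move: `|x - m| => u; nra.
have b2 := ler_wpM2r (normal_pdf_ge0 m s x) b1.
have b3 := ler_wpM2l (mulr_ge0 C0 (ler0n _ 2)) (hK x).
have b4 := ler_wpM2l K0 (hK2 x).
have b5 := ler_wpM2l K20 (normal_pdf_ub m x (_ : 2 * (2 * s) != 0)).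
have b45 : K * ((1 + (x - m) ^+ 2) * normal_pdf m (2 * s) x) <= K * (K2 * normal_peak (2 * (2 * s))).
  apply: le_trans b4 _; rewrite ler_wpM2l// b5//.
  by rewrite mulf_neq0// pnatr_eq0.
have u1 : 0 <= 1 + (x - m) ^+ 2 by rewrite addr_ge0.
apply: le_trans (ler_wpM2r u1 b2) _.
have := ler_wpM2r u1 b3; have := ler_wpM2l (mulr_ge0 C0 (ler0n _ 2)) b45.
rewrite !mulrA => c1 c2; apply: le_trans _ c1.
by move: c2; rewrite [X in _ -> _ <= X]mulrAC -!mulrA => c2; apply: le_trans c2 _; rewrite !mulrA // lexx.
Qed.

End stein1.

(** * Products of laws on the line *)
Section product_law.
Context {R : realType}.
Local Notation RT := (measurableTypeR R).

Definition upd n (v : 'cV[R]_n) (i : 'I_n) (x : R) : 'cV[R]_n :=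
  \col_j (if j == i then x else v j 0).

Lemma cV_cons_upd0 n x (v : 'cV[R]_n) :
  cV_cons (x, v) = upd (cV_cons (0, v)) ord0 x.
Proof.
apply/matrixP => i j; rewrite [j]ord1 [RHS]mxE.
have [l ->|->] := unliftP ord0 i; last by rewrite cV_cons0 eqxx.
by rewrite !cV_consS eq_sym (negbTE (neq_lift _ _)).
Qed.

Lemma cV_cons_upd n (x : R) (v : 'cV[R]_n) j y :
  cV_cons (x, upd v j y) = upd (cV_cons (x, v)) (lift ord0 j) y.
Proof.
apply/matrixP => i l; rewrite [l]ord1 [RHS]mxE.
have [k ->|->] := unliftP ord0 i.
  by rewrite !cV_consS mxE (inj_eq lift_inj).
by rewrite !cV_cons0 (negbTE (neq_lift _ _)).
Qed.

Lemma ge0_integral_cV_prodS n (P : 'I_n.+1 -> probability RT R)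
    (g : 'cV[R]_n.+1 -> \bar R) : measurable_fun setT g -> (forall v, 0 <= g v)%E ->
  (\int[cV_prod_law P]_v g v =
   \int[P ord0]_x \int[cV_prod_law (fun i => P (lift ord0 i))]_v g (cV_cons (x, v)))%E.
Proof.
move=> mg g0 /=; rewrite ge0_integral_distribution//.
rewrite (fubini_tonelli1 (g \o @cV_cons R n))//=.
by apply: measurableT_comp => //; exact: measurable_cV_cons.
Qed.

(** Fubini in the i-th coordinate.  As the law is built one coordinate at a
    time, this is an induction: either i is the coordinate split off first, or
    it is inside the remaining vector, where the claim holds for almost every
    value of the first coordinate. *)
Lemma cV_prod_fiber0 n (P : 'I_n -> probability RT R) (G : 'cV[R]_n -> R) (i : 'I_n) :
  (cV_prod_law P).-integrable setT (EFin \o G) ->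
  (forall v, \int[P i]_x (G (upd v i x))%:E = 0)%E ->
  (\int[cV_prod_law P]_v (G v)%:E = 0)%E.
Proof.
elim: n => [|n IH] in P G i *; first by case: i.
move=> iG G0.
have mG := measurable_int _ iG.
pose P' := fun i => P (lift ord0 i).
have iGc : (P ord0 \x cV_prod_law P')%E.-integrable setT ((EFin \o G) \o @cV_cons R n).
  apply/integrableP; split.
    by apply: measurableT_comp => //; exact: measurable_cV_cons.
  case/integrableP: iG => _; rewrite /= ge0_integral_distribution//.
  by apply/measurable_EFinP; apply: measurableT_comp => //; exact/measurable_EFinP.
rewrite /= integral_distribution//.
have [j ij|ij] := unliftP ord0 i; rewrite ij in G0.
- rewrite -integral12_prod_meas1//.
  rewrite (ae_eq_integral (cst 0)%E)//; first by rewrite integral0.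
    exact: measurable_int (integrable_fubini_F iGc).
  apply: filterS (ae_integrable1 iGc) => x ix _ /=.
  apply: (IH P' (fun v => G (cV_cons (x, v))) j) => //.
  by move=> v; under eq_integral do rewrite cV_cons_upd; exact: G0.
- rewrite -integral21_prod_meas1//; rewrite integral0_eq// => v _.
  rewrite /fubini_G; under eq_integral do rewrite /= cV_cons_upd0; exact: G0.
Qed.

Lemma cV_prod_density n (P P' : 'I_n -> probability RT R) (w : 'I_n -> R -> R) :
  (forall i x, 0 <= w i x) -> (forall i, measurable_fun setT (w i)) ->
  (forall i, has_density (P' i) (P i) (w i)) ->
  has_density (cV_prod_law P') (cV_prod_law P) (fun v => \prod_i w i (v i 0)).
Proof.
elim: n => [|n IH] in P P' w *.
  move=> _ _ _ g mg g0 /=; rewrite !integral_dirac//=.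
  by rewrite big_ord0 mule1.
  apply: emeasurable_funM; first exact: mg.
  by under eq_fun do rewrite big_ord0; exact: measurable_cst.
move=> w0 mw dw g mg g0.
have mp : measurable_fun setT (fun v : 'cV[R]_n => \prod_i w (lift ord0 i) (v i 0)).
  apply: measurable_prod => i _.
  exact: (measurableT_comp (mw _) (measurable_coor i)).
have mp' : measurable_fun setT (fun v : 'cV[R]_n.+1 => \prod_i w i (v i 0)).
  apply: measurable_prod => i _.
  exact: (measurableT_comp (mw _) (measurable_coor i)).
have p0 : forall v : 'cV[R]_n, 0 <= \prod_i w (lift ord0 i) (v i 0).
  by move=> v; apply: prodr_ge0.
rewrite !ge0_integral_cV_prodS//; first last.
- by move=> v; rewrite mule_ge0// lee_fin prodr_ge0.
- by apply: emeasurable_funM => //; exact/measurable_EFinP.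
have mgc x : measurable_fun setT (fun v => g (cV_cons (x, v))).
  apply: (measurableT_comp mg); apply: (measurableT_comp (@measurable_cV_cons R n)).
  exact: measurable_fun_pair.
rewrite dw; first last.
- by move=> x; apply: integral_ge0.
- apply: (measurable_fun_fubini_tonelli_F (g \o @cV_cons R n)).
    by apply: (measurableT_comp mg); exact: measurable_cV_cons.
  by move=> z; exact: g0.
apply: eq_integral => x _.
rewrite (IH (fun i => P (lift ord0 i)) _ (fun i => w (lift ord0 i)))//.
rewrite -ge0_integralZr//; first last.
- by rewrite lee_fin.
- by move=> v _; rewrite mule_ge0// lee_fin.
- by apply: emeasurable_funM => //; exact/measurable_EFinP.
apply: eq_integral => v _; rewrite -muleA -EFinM; congr (_ * _%:E)%E.
rewrite big_ord_recl cV_cons0 mulrC; congr (_ * _).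
by apply: eq_bigr => i _; rewrite cV_consS.
Qed.

Lemma ge0_integral_cV_prod_coor n (P : 'I_n -> probability RT R) i (g : R -> \bar R) :
  measurable_fun setT g -> (forall x, 0 <= g x)%E ->
  (\int[cV_prod_law P]_v g (v i 0%R) = \int[P i]_x g x)%E.
Proof.
move=> mg g0; elim: n => [|n IH] in P i *; first by case: i.
have mgi : measurable_fun setT (fun v : 'cV[R]_n.+1 => g (v i 0)).
  exact: (measurableT_comp mg (measurable_coor i)).
rewrite ge0_integral_cV_prodS//; have [j ->|->] := unliftP ord0 i.
- under eq_integral do under eq_integral do rewrite cV_consS.
  under eq_integral do rewrite IH.
  exact: prob_integral_cst.
- under eq_integral do under eq_integral do rewrite cV_cons0.
  by apply: eq_integral => x _ /=; exact: prob_integral_cst.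
Qed.

End product_law.

(** * Normal vectors *)
Section measurable_vectors.
Context {R : realType} {d : measure_display} {T : measurableType d}.

Lemma measurable_coorT n (f : T -> 'cV[R]_n) i : measurable_fun setT f ->
  measurable_fun setT (fun x => f x i 0).
Proof. by move=> mf; exact: (measurableT_comp (measurable_coor i) mf). Qed.

Lemma measurable_dot n (f g : T -> 'cV[R]_n) : measurable_fun setT f ->
  measurable_fun setT g -> measurable_fun setT (fun x => dot (f x) (g x)).
Proof.
move=> mf mg; apply: measurable_sum => i.
by apply: measurable_funM; exact: measurable_coorT.
Qed.

Lemma measurable_mulmx n p (A : 'M[R]_(p, n)) (f : T -> 'cV[R]_n) :
  measurable_fun setT f -> measurable_fun setT (fun x => A *m f x).
Proof.
move=> mf; apply/measurable_fun_cVP => i; under eq_fun do rewrite mxE.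
apply: measurable_sum => j; apply: measurable_funM => //.
exact: measurable_coorT.
Qed.

Lemma measurable_submx n (f g : T -> 'cV[R]_n) : measurable_fun setT f ->
  measurable_fun setT g -> measurable_fun setT (fun x => f x - g x).
Proof.
move=> mf mg; apply/measurable_fun_cVP => i; under eq_fun do rewrite !mxE.
by apply: measurable_funB; exact: measurable_coorT.
Qed.

Lemma measurable_scalemx n (a : T -> R) (g : T -> 'cV[R]_n) : measurable_fun setT a ->
  measurable_fun setT g -> measurable_fun setT (fun x => a x *: g x).
Proof.
move=> mf mg; apply/measurable_fun_cVP => i; under eq_fun do rewrite !mxE.
by apply: measurable_funM => //; exact: measurable_coorT.
Qed.

Lemma measurable_qform n (A : 'M[R]_n) (f : T -> 'cV[R]_n) :
  measurable_fun setT f -> measurable_fun setT (fun x => qform A (f x)).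
Proof.
move=> mf; under eq_fun do rewrite qformE.
by apply: measurable_dot => //; exact: measurable_mulmx.
Qed.

Lemma measurable_inv_add1 (g : T -> R) : measurable_fun setT g -> (forall x, 0 <= g x) ->
  measurable_fun setT (fun x => (g x + 1)^-1).
Proof.
move=> mg g0; have cinv : measurable_fun setT (fun x : R => (`|x| + 1)^-1).
  apply: continuous_measurable_fun => x; apply: cvgV; first by rewrite gt_eqF// ltr_wpDl.
  by apply: cvgD; [apply: cvg_norm; exact: cvg_id|exact: cvg_cst].
rewrite (_ : (fun y => _) = (fun x : R => (`|x| + 1)^-1) \o g).
  exact: measurableT_comp.
by apply/funext => y /=; rewrite ger0_norm.
Qed.

End measurable_vectors.

Lemma upd_mul {R : realType} p k (M : 'M[R]_(p, k)) v i x j :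
  (M *m upd v i x) j 0 = (M *m upd v i 0) j 0 + M j i * x.
Proof.
rewrite !mxE (bigD1 i)//= [in RHS](bigD1 i)//= !mxE eqxx mulr0 add0r addrC; congr (_ + _).
by apply: eq_bigr => l li; rewrite !mxE (negbTE li).
Qed.

Lemma dot_upd {R : realType} n (v : 'cV[R]_n) a x :
  dot (upd v a x) (upd v a x) = dot (upd v a 0) (upd v a 0) + x ^+ 2.
Proof.
rewrite /dot (bigD1 a)//= [in RHS](bigD1 a)//= !mxE eqxx mulr0 add0r addrC expr2.
by congr (_ + _); apply: eq_bigr => l la; rewrite !mxE (negbTE la).
Qed.
Section gaussian_vectors.
Context {R : realType} {k : nat}.
Variable d : 'rV[R]_k.
Hypothesis d_gt0 : forall i, 0 < d 0 i.
Implicit Types mu y : 'cV[R]_k.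

Let sd0 i : Num.sqrt (d 0 i) != 0.
Proof. by rewrite gt_eqF// sqrtr_gt0. Qed.

Let sdE i : Num.sqrt (d 0 i) ^+ 2 = d 0 i.
Proof. by rewrite sqr_sqrtr// ltW. Qed.

(** The density of N(mu, D) with respect to N(0, D). *)
Definition lik mu y : R :=
  expR (\sum_i (mu i 0 * y i 0 - mu i 0 ^+ 2 / 2) / d 0 i).

Lemma lik_gt0 mu y : 0 < lik mu y. Proof. exact: expR_gt0. Qed.

Lemma measurable_lik {e : measure_display} {T : measurableType e} (f g : T -> 'cV[R]_k) :
  measurable_fun setT f -> measurable_fun setT g ->
  measurable_fun setT (fun x => lik (f x) (g x)).
Proof.
move=> mf mg; apply: measurableT_comp => //; apply: measurable_sum => i.
apply: measurable_funM => //; apply: measurable_funB.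
  by apply: measurable_funM; exact: measurable_coorT.
by apply: measurable_funM => //; apply: measurable_funX; exact: measurable_coorT.
Qed.

Lemma diag_normal_density mu :
  has_density (diag_normal d mu) (diag_normal d 0) (lik mu).
Proof.
have -> : lik mu = fun v => \prod_i (fun x : R => expR ((mu i 0 * x - mu i 0 ^+ 2 / 2) / d 0 i)) (v i 0).
  by apply/funext => v; rewrite -expR_sum.
apply: (@cV_prod_density R k _ _ (fun i x => expR ((mu i 0 * x - mu i 0 ^+ 2 / 2) / d 0 i))).
- by move=> i x; exact: expR_ge0.
- move=> i; apply: measurableT_comp => //; apply: measurable_funM => //.
  by apply: measurable_funB => //; exact: measurable_funM.
- by move=> i; have := normal_density_mean (mu i 0) (sd0 i); rewrite sdE mxE.
Qed.

Lemma diag_normal_coor mu i (g : R -> \bar R) :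
  measurable_fun setT g -> (forall x, 0 <= g x)%E ->
  (\int[diag_normal d mu]_v g (v i 0%R) =
   \int[normal_prob (mu i 0%R) (Num.sqrt (d 0%R i))]_x g x)%E.
Proof. exact: ge0_integral_cV_prod_coor. Qed.

Lemma diag_normal_integrable_sqr mu i :
  (diag_normal d mu).-integrable setT (fun y => ((y i 0 - mu i 0) ^+ 2)%:E).
Proof.
have m1 : measurable_fun setT (fun x : R => (x - mu i 0) ^+ 2).
  by apply: measurable_funX; exact: measurable_funB.
apply/integrableP; split.
  by apply/measurable_EFinP; exact: (measurableT_comp m1 (measurable_coor i)).
rewrite (diag_normal_coor mu i (g := fun x => `|((x - mu i 0) ^+ 2)%:E|%E))//; last first.
  by apply: measurableT_comp => //; exact/measurable_EFinP.
have b1 x : `|(x - mu i 0) ^+ 2| <= 1 * (1 + (x - mu i 0) ^+ 2).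
  by rewrite ger0_norm ?sqr_ge0// mul1r lerDr.
by have /integrableP[] := normal_integrable (sd0 i) m1 b1.
Qed.

Lemma diag_normal_integrable_dot mu :
  (diag_normal d mu).-integrable setT (fun y => (dot (y - mu) (y - mu))%:E).
Proof.
under eq_fun do rewrite /dot -sumEFin.
apply: integrable_sum => // i _.
by under eq_fun do rewrite !mxE -expr2; exact: diag_normal_integrable_sqr.
Qed.

(** Stein's identity holds on every line parallel to the i-th axis, hence on the
    whole space by Fubini. *)
Lemma diag_normal_stein mu i (h hi : 'cV[R]_k -> R) :
  (diag_normal d mu).-integrable setT
    (fun y => ((y i 0 - mu i 0) * h y - d 0 i * hi y)%:E) ->
  (forall v x, is_derive x (1 : R) (fun x => h (upd v i x)) (hi (upd v i x))) ->
  (forall v, continuous (fun x => hi (upd v i x))) ->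
  (forall v, exists C, forall x, `|h (upd v i x)| <= C * (1 + `|x - mu i 0|) /\
     `|hi (upd v i x)| <= C * (1 + `|x - mu i 0|)) ->
  (\int[diag_normal d mu]_y ((y i 0 - mu i 0) * h y - d 0 i * hi y)%:E = 0)%E.
Proof.
move=> ih dh ch bh; apply: (cV_prod_fiber0 (i := i)) => // v.
have [C hC] := bh v.
under eq_integral do rewrite mxE eqxx -[X in X * hi _]sdE.
apply: (@normal_stein R _ _ (fun x => h (upd v i x)) (fun x => hi (upd v i x)) C) => //.
- by move=> x; case: (hC x).
- by move=> x; case: (hC x).
Qed.

(** The risk of y does not depend on mu.  Each term (y_i - mu_i) (M (y - mu))_i
    is evaluated by Stein's identity, the derivative being the constant M_ii. *)
Lemma diag_normal_qform mu (M : 'M[R]_k) :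
  (diag_normal d mu).-integrable setT (fun y => (qform M (y - mu))%:E) /\
  (\int[diag_normal d mu]_y (qform M (y - mu))%:E = (\sum_i d 0 i * M i i)%:E)%E.
Proof.
have mid : measurable_fun setT (@id 'cV[R]_k) by exact: measurable_id.
have mym : measurable_fun setT (fun y : 'cV[R]_k => y - mu) by exact: measurable_submx.
have iM (N : 'M[R]_k) : (diag_normal d mu).-integrable setT (fun y => (qform N (y - mu))%:E).
  have [C C0 hC] := qform_le N.
  apply: (@le_integrable _ _ _ _ _ measurableT _ (fun y => C%:E * (dot (y - mu) (y - mu))%:E)%E).
  - by apply/measurable_EFinP; exact: measurable_qform.
  - move=> y _; rewrite -EFinM /= lee_fin (le_trans (hC _))//.
    by rewrite ger0_norm// mulr_ge0// dot_ge0.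
  - by apply: integrableZl => //; exact: diag_normal_integrable_dot.
split=> //.
pose h i y := (M *m (y - mu)) i 0.
have H i : (diag_normal d mu).-integrable setT (fun y => ((y i 0 - mu i 0) * h i y)%:E) /\
    (\int[diag_normal d mu]_y ((y i 0 - mu i 0) * h i y)%:E = (d 0 i * M i i)%:E)%E.
  have ih : (diag_normal d mu).-integrable setT (fun y => ((y i 0 - mu i 0) * h i y)%:E).
    have E y : (y i 0 - mu i 0) * h i y = qform (delta_mx i i *m M) (y - mu).
      have dE j : (delta_mx i i *m (M *m (y - mu))) j 0 = (j == i)%:R * h i y.
        rewrite mxE (bigD1 i)//= big1 ?addr0 => [|l li]; rewrite mxE ?eqxx ?andbT//.
        by rewrite (negbTE li) andbF mul0r.
      rewrite qformE -mulmxA /dot (bigD1 i)//= big1 ?addr0 => [|j ji].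
        by rewrite dE eqxx mul1r !mxE.
      by rewrite dE (negbTE ji) mul0r mulr0.
    by under eq_fun do rewrite E; exact: iM.
  split=> //.
  have ic : (diag_normal d mu).-integrable setT (fun y => (d 0 i * M i i)%:E).
    exact: finite_measure_integrable_cst.
  have E y : ((y i 0 - mu i 0) * h i y - d 0 i * M i i)%:E =
    (((y i 0 - mu i 0) * h i y)%:E - (d 0 i * M i i)%:E)%E by rewrite EFinB.
  have key : (\int[diag_normal d mu]_y ((y i 0 - mu i 0) * h i y - d 0 i * M i i)%:E = 0)%E.
    apply: (@diag_normal_stein mu i (h i) (fun=> M i i)).
    - by under eq_fun do rewrite E; exact: integrableB.
    - move=> v x.
      have E2 z : h i (upd v i z) = (M *m upd v i 0 - M *m mu) i 0 + M i i * z + 0 * z ^+ 2.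
        by rewrite /h mulmxBr [LHS]mxE [X in _ = X + _ + _]mxE upd_mul; ring.
      under eq_fun do rewrite E2.
      have := is_derive_quadratic ((M *m upd v i 0 - M *m mu) i 0) (M i i) 0 x.
      by move/is_derive_eq; apply; ring.
    - by move=> v x; exact: cvg_cst.
    - move=> v.
      pose c := (M *m upd v i (mu i 0) - M *m mu) i 0.
      exists (`|c| + `|M i i|) => x.
      have -> : h i (upd v i x) = c + M i i * (x - mu i 0).
        rewrite /h /c mulmxBr [LHS]mxE [X in _ = X + _]mxE (upd_mul M v i x i) (upd_mul M v i (mu i 0) i); ring.
      split.
        apply: le_trans (ler_normD _ _) _; rewrite normrM.
        by move: (normr_ge0 c) (normr_ge0 (M i i)) (normr_ge0 (x - mu i 0)); nra.
      by move: (normr_ge0 c) (normr_ge0 (M i i)) (normr_ge0 (x - mu i 0)); nra.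
  move: key; under eq_integral do rewrite E.
  rewrite integralB// prob_integral_cst => /eqP; rewrite sube_eq ?add0e; first by move/eqP.
    exact: integrable_fin_num.
  by rewrite fin_num_adde_defl.
have E y : (qform M (y - mu))%:E = (\sum_i ((y i 0 - mu i 0) * h i y)%:E)%E.
  by rewrite sumEFin qformE /dot; congr (_%:E); apply: eq_bigr => i _; rewrite /h !mxE.
under eq_integral do rewrite E.
rewrite integral_sum//; last by move=> i; case: (H i).
by rewrite -sumEFin; apply: eq_bigr => i _; case: (H i).
Qed.

End gaussian_vectors.

(** * Integration by parts along a slice of the mean space *)
Section isotropic.
Context {R : realType} {n : nat}.

Lemma isotropic_density (v kap : R) : 0 < v -> 0 <= kap ->
  has_density (diag_normal (const_mx (v / (1 + 2 * kap * v))) (0 : 'cV[R]_n))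
    (diag_normal (const_mx v) (0 : 'cV[R]_n))
    (fun th => Num.sqrt (1 + 2 * kap * v) ^+ n * expR (- kap * dot th th)).
Proof.
move=> v0 k0.
have -> : (fun th : 'cV[R]_n => Num.sqrt (1 + 2 * kap * v) ^+ n * expR (- kap * dot th th)) =
  fun th => \prod_(i < n) (fun x : R => Num.sqrt (1 + 2 * kap * v) * expR (- kap * x ^+ 2)) (th i 0).
  apply/funext => th; rewrite big_split /= prodr_const card_ord -expR_sum /dot mulr_sumr.
  by under eq_bigr do rewrite -expr2.
apply: (@cV_prod_density R n _ _
  (fun i x => Num.sqrt (1 + 2 * kap * v) * expR (- kap * x ^+ 2))).
- by move=> i x; rewrite mulr_ge0// expR_ge0.
- move=> i; apply: measurable_funM => //; apply: measurableT_comp => //.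
  by apply: measurable_funM => //; exact: measurable_funX.
- by move=> i; rewrite !mxE; exact: normal_density_variance.
Qed.

End isotropic.

Section integration_by_parts.
Context {R : realType} {k n : nat}.
Variables (d : 'rV[R]_k) (A : 'M[R]_(n, k)) (f : 'cV[R]_k -> 'cV[R]_n) (C S : R).
Hypotheses (d_gt0 : forall i, 0 < d 0 i) (mf : measurable_fun setT f) (S_gt0 : 0 < S).

(** The matrix D A^T.  For mu = D A^T th the gradient in th of the
    log-likelihood is D-free: it is A (y - mu), the quantity that occurs in the
    comparison of risks. *)
Definition slice : 'M[R]_(k, n) := \matrix_(i, a) (d 0 i * A a i).

Local Notation B := slice.
Local Notation nu := (diag_normal d 0).
Local Notation rho := (diag_normal (const_mx S) (0 : 'cV[R]_n)).
Local Notation L th y := (lik d (B *m th) y).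
Local Notation w th y := (A *m (y - B *m th)).

Hypothesis fC : forall th,
  (\int[diag_normal d (B *m th)]_y (dot (f y) (f y))%:E <= C%:E)%E.

(* an integrable majorant for all the functions of (th, y) below *)
Let env (z : 'cV[R]_n * 'cV[R]_k) : R := L z.1 z.2 *
  (1 + dot (f z.2) (f z.2) + dot (w z.1 z.2) (w z.1 z.2) + dot z.1 z.1).

Let m1 : measurable_fun setT (fun z : 'cV[R]_n * 'cV[R]_k => z.1).
Proof. exact: measurable_fst. Qed.

Let m2 : measurable_fun setT (fun z : 'cV[R]_n * 'cV[R]_k => z.2).
Proof. exact: measurable_snd. Qed.

Let mf2 : measurable_fun setT (fun z : 'cV[R]_n * 'cV[R]_k => f z.2).
Proof. exact: (measurableT_comp mf measurable_snd). Qed.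

Let mL : measurable_fun setT (fun z : 'cV[R]_n * 'cV[R]_k => L z.1 z.2).
Proof. by apply: measurable_lik => //; exact: measurable_mulmx. Qed.

Let mw : measurable_fun setT (fun z : 'cV[R]_n * 'cV[R]_k => w z.1 z.2).
Proof.
apply: measurable_mulmx; apply: measurable_submx => //; exact: measurable_mulmx.
Qed.

Let me kap : measurable_fun setT
  (fun z : 'cV[R]_n * 'cV[R]_k => expR (- kap * dot z.1 z.1)).
Proof.
by apply: measurableT_comp => //; apply: measurable_funM => //; exact: measurable_dot.
Qed.

Let menv : measurable_fun setT env.
Proof.
apply: measurable_funM => //; apply: measurable_funD; last exact: measurable_dot.
apply: measurable_funD; last exact: measurable_dot.
by apply: measurable_funD => //; exact: measurable_dot.
Qed.

Let env_ge0 z : 0 <= env z.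
Proof.
by apply: mulr_ge0; [exact/ltW/lik_gt0|rewrite !addr_ge0// dot_ge0].
Qed.

Lemma isotropic_integrable_dot : rho.-integrable setT (fun th => (dot th th)%:E).
Proof.
have S0 i : 0 < (const_mx S : 'rV[R]_n) 0 i by rewrite mxE.
have := diag_normal_integrable_dot S0 0.
by under eq_fun do rewrite subr0.
Qed.

Let T := \sum_i d 0 i * (A^T *m A) i i.

Let wT th : (\int[diag_normal d (B *m th)]_y (dot (w th y) (w th y))%:E = T%:E)%E.
Proof.
under eq_integral do rewrite -qform_gram.
by have [] := diag_normal_qform d_gt0 (B *m th) (A^T *m A).
Qed.

Let ienv : (rho \x nu)%E.-integrable setT (EFin \o env).
Proof.
apply/integrable12ltyP; first exact/measurable_EFinP.
apply: (@le_lt_trans _ _ (\int[rho]_th ((1 + C + T)%:E + (dot th th)%:E))%E); last first.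
  apply: integrable_lty => //; apply: integrableD => //; last exact: isotropic_integrable_dot.
  exact: finite_measure_integrable_cst.
have mdf : measurable_fun setT (fun y => dot (f y) (f y)) by exact: measurable_dot.
have mwth (th : 'cV[R]_n) : measurable_fun setT (fun y : 'cV[R]_k => dot (w th y) (w th y)).
  have ? : measurable_fun setT (fun y : 'cV[R]_k => w th y).
    by apply: measurable_mulmx; exact: measurable_submx.
  exact: measurable_dot.
have E th : (\int[nu]_y `|(EFin \o env) (th, y)| <= (1 + C + T)%:E + (dot th th)%:E)%E.
  pose g y := 1 + dot (f y) (f y) + dot (w th y) (w th y) + dot th th.
  have -> : (\int[nu]_y `|(EFin \o env) (th, y)| = \int[diag_normal d (B *m th)]_y (g y)%:E)%E.
    have mg : measurable_fun setT (fun y => (g y)%:E).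
      apply/measurable_EFinP; apply: measurable_funD => //; apply: measurable_funD => //.
      exact: measurable_funD.
    have g0 y : (0 <= (g y)%:E)%E by rewrite lee_fin !addr_ge0// dot_ge0.
    apply/esym; apply: etrans (diag_normal_density d_gt0 (B *m th) mg g0) _.
    apply: eq_integral => y _; rewrite gee0_abs; last by rewrite lee_fin.
    by rewrite /= /env/= mulrC EFinM.
  under eq_integral do rewrite !EFinD.
  rewrite ge0_integralD//=; first last.
  - by move=> *; rewrite lee_fin dot_ge0.
  - apply/measurable_EFinP; apply: measurable_funD => //; exact: measurable_funD.
  - by move=> y _; rewrite lee_fin !addr_ge0// dot_ge0.
  rewrite ge0_integralD//=; first last.
  - exact/measurable_EFinP.
  - by move=> y _; rewrite lee_fin dot_ge0.
  - apply/measurable_EFinP; exact: measurable_funD.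
  - by move=> y _; rewrite lee_fin !addr_ge0// dot_ge0.
  rewrite ge0_integralD//=; first last.
  - exact/measurable_EFinP.
  - by move=> y _; rewrite lee_fin dot_ge0.
  rewrite wT !prob_integral_cst !EFinD leeD// leeD// leeD//.
apply: ge0_le_integral => //.
- by move=> th _; apply: integral_ge0.
- apply: (measurable_fun_fubini_tonelli_F (fun z => `|(EFin \o env) z|)%E) => //.
  by apply: measurableT_comp => //; exact/measurable_EFinP.
- by apply: emeasurable_funD => //; apply/measurable_EFinP; exact: measurable_dot.
Qed.

Let dominated (g : 'cV[R]_n * 'cV[R]_k -> R) K : measurable_fun setT g ->
  (forall z, `|g z| <= K * env z) -> (rho \x nu)%E.-integrable setT (EFin \o g).
Proof.
move=> mg gK; apply: (@le_integrable _ _ _ _ _ measurableT _ (fun z => K%:E * (env z)%:E)%E).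
- exact/measurable_EFinP.
- by move=> z _; rewrite -EFinM lee_fin (le_trans (gK z))// ler_norm.
- exact: integrableZl.
Qed.

(* the a-th coordinate of f times the gradient in th of the joint weight
   exp (- kap |th|^2) lik, taken relative to the Gaussian density rho *)
Let score_comp kap (a : 'I_n) (z : 'cV[R]_n * 'cV[R]_k) : R :=
  expR (- kap * dot z.1 z.1) * L z.1 z.2 *
  (f z.2 a 0 * ((w z.1 z.2) a 0 - (S^-1 + 2 * kap) * z.1 a 0)).

Let env1 kap z g K : 0 <= kap -> `|g| <= K *
   (1 + dot (f z.2) (f z.2) + dot (w z.1 z.2) (w z.1 z.2) + dot z.1 z.1) ->
  `|expR (- kap * dot z.1 z.1) * L z.1 z.2 * g| <= K * env z.
Proof.
move=> k0 gK; rewrite !normrM (ger0_norm (expR_ge0 _)) (ger0_norm (ltW (lik_gt0 _ _ _))).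
apply: (@le_trans _ _ (L z.1 z.2 * `|g|)).
  apply: ler_wpM2r => //; apply: ler_piMl; first exact/ltW/lik_gt0.
  by rewrite -[leRHS]expR0 ler_expR mulNr oppr_le0 mulr_ge0// dot_ge0.
by rewrite mulrCA; apply: ler_wpM2l => //; exact/ltW/lik_gt0.
Qed.

Let iscore kap a : 0 <= kap -> (rho \x nu)%E.-integrable setT (EFin \o score_comp kap a).
Proof.
move=> k0; set c := S^-1 + 2 * kap.
apply: (@dominated _ (1 + c ^+ 2)).
  apply: measurable_funM; first exact: measurable_funM.
  apply: measurable_funM; first exact: measurable_coorT.
  apply: measurable_funB; first exact: measurable_coorT.
  by apply: measurable_funM => //; exact: measurable_coorT.
move=> z; apply: env1 => //; rewrite -/c.
have := coor_sqr_le (f z.2) a; have := coor_sqr_le (w z.1 z.2) a; have := coor_sqr_le z.1 a.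
move: (f z.2 a 0) (w z.1 z.2 a 0) (z.1 a 0) => x y t.
move: (dot _ _) (dot _ _) (dot _ _) => x2 y2 t2 ht hy hx.
have c2 : 0 <= c ^+ 2 by exact: sqr_ge0.
have x0 : 0 <= x2 := le_trans (sqr_ge0 x) hx.
have y0 : 0 <= y2 := le_trans (sqr_ge0 y) hy.
have t0 : 0 <= t2 := le_trans (sqr_ge0 t) ht.
have e1 : c ^+ 2 * t ^+ 2 <= c ^+ 2 * t2 by rewrite ler_wpM2l.
have e2 : 0 <= c ^+ 2 * (1 + x2 + y2) by rewrite mulr_ge0// !addr_ge0.
have h1 := sqr_ge0 (x - y); have h2 := sqr_ge0 (x + y).
have h3 := sqr_ge0 (x - c * t); have h4 := sqr_ge0 (x + c * t).
by rewrite ler_norml; apply/andP; split; nra.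
Qed.

(* along each coordinate line of th the joint weight is the exponential of a
   strictly concave quadratic, with bounded derivatives of every order *)
Let score_fiber kap (a : 'I_n) (th : 'cV[R]_n) (y : 'cV[R]_k) : 0 < kap ->
  exists g b c : R, c < 0 /\ forall x,
    expR (- kap * dot (upd th a x) (upd th a x)) * L (upd th a x) y =
      expR (g + b * x + c * x ^+ 2) /\
    (w (upd th a x) y) a 0 - 2 * kap * x = b + 2 * c * x.
Proof.
move=> k0.
pose u := B *m upd th a 0.
pose g := \sum_i (u i 0 * y i 0 - u i 0 ^+ 2 / 2) / d 0 i.
pose b := \sum_i B i a * (y i 0 - u i 0) / d 0 i.
pose c := \sum_i B i a ^+ 2 / (2 * d 0 i).
have c0 : 0 <= c.
  by apply: sumr_ge0 => i _; rewrite divr_ge0 ?sqr_ge0// mulr_ge0// ltW.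
exists (- kap * dot (upd th a 0) (upd th a 0) + g), b, (- kap - c); split; first lra.
move=> x; split.
  rewrite -expRD; congr expR; rewrite dot_upd.
  under eq_bigr do rewrite upd_mul -/u.
  have -> : \sum_i ((u i 0 + B i a * x) * y i 0 - (u i 0 + B i a * x) ^+ 2 / 2) / d 0 i =
      g + b * x - c * x ^+ 2.
    rewrite /g /b /c !mulr_suml -big_split -sumrB /=; apply: eq_bigr => i _.
    by field; rewrite gt_eqF.
  ring.
rewrite mxE.
have -> : \sum_j A a j * (y - B *m upd th a x) j 0 = b - 2 * c * x.
  rewrite /b /c mulr_sumr mulr_suml -sumrB; apply: eq_bigr => i _.
  rewrite [X in _ * X]mxE [X in _ * (_ + X)]mxE upd_mul -/u !mxE.
  by field; rewrite gt_eqF.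
ring.
Qed.

(** For almost every y, this is Stein's identity under rho = N(0, S) for the
    function th |-> f_a(y) exp (- kap |th|^2) lik th y.  Only derivatives in th
    are taken, so f enters as a constant. *)
Lemma integral_score kap a : 0 < kap ->
  (\int[(rho \x nu)%E]_z (score_comp kap a z)%:E = 0)%E.
Proof.
move=> k0; have isc := iscore a (ltW k0).
rewrite -(integral21_prod_meas1 isc) (ae_eq_integral (cst 0)%E)//; first by rewrite integral0.
  exact: measurable_fubini_G isc.
apply: filterS (ae_integrable2 isc) => y iy _ /=; rewrite /fubini_G.
pose E (th : 'cV[R]_n) := expR (- kap * dot th th) * L th y.
pose h (th : 'cV[R]_n) := f y a 0 * E th.
pose hi (th : 'cV[R]_n) := f y a 0 * (((w th y) a 0 - 2 * kap * th a 0) * E th).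
have S0 i : 0 < (const_mx S : 'rV[R]_n) 0 i by rewrite mxE.
have sE (th : 'cV[R]_n) : ((th a 0 - (0 : 'cV[R]_n) a 0) * h th - (const_mx S : 'rV[R]_n) 0 a * hi th)%:E =
  ((- S)%:E * (score_comp kap a (th, y))%:E)%E.
  rewrite -EFinM; congr (_%:E); rewrite /score_comp /h /hi /E !mxE /=.
  by field; rewrite gt_eqF.
have -> : (\int[rho]_x (EFin \o score_comp kap a) (x, y) =
   (- S^-1)%:E * \int[rho]_x ((- S)%:E * (score_comp kap a (x, y))%:E))%E.
  by rewrite integralZl// muleA -EFinM mulrNN mulVf ?gt_eqF// mul1e.
under eq_integral do rewrite -sE.
rewrite [X in (_ * X)%E](_ : _ = 0%E) ?mule0//.
apply: (@diag_normal_stein R n (const_mx S) S0 0 a h hi).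
- rewrite (_ : (fun _ => _) = fun th => ((- S)%:E * (score_comp kap a (th, y))%:E)%E).
    exact: integrableZl.
  by apply/funext => th; rewrite sE.
- move=> th x.
  have [g [b [c [c0 H]]]] := score_fiber a th y k0.
  have Ex z : E (upd th a z) = expR (g + b * z + c * z ^+ 2) by rewrite /E; case: (H z).
  rewrite /h /hi.
  have -> : (fun x0 => f y a 0 * E (upd th a x0)) =
     cst (f y a 0) * (fun z => expR (g + b * z + c * z ^+ 2)).
    by apply/funext => z; rewrite Ex.
  have h1 := is_derive_exp_quadratic g b c x.
  have h2 := is_derive_cst (f y a 0) x (1 : R).
  apply: (is_derive_eq (is_deriveM h2 h1)).
  rewrite /GRing.scale /= mulr0 addr0 Ex [upd th a x a 0]mxE eqxx.
  by case: (H x) => _ ->.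
- move=> th.
  have [g [b [c [c0 H]]]] := score_fiber a th y k0.
  have -> : (fun x => hi (upd th a x)) =
     (fun x => f y a 0 * ((b + 2 * c * x) * expR (g + b * x + c * x ^+ 2))).
    apply/funext => z; rewrite /hi /E [upd th a z a 0]mxE eqxx.
    by case: (H z) => -> ->.
  have cE := is_derive_continuous (is_derive_exp_quadratic g b c).
  move=> x; apply: cvgM; first exact: cvg_cst.
  apply: cvgM; last exact: cE.
  by apply: cvgD; [exact: cvg_cst|apply: cvgM; [exact: cvg_cst|exact: cvg_id]].
- move=> th.
  have [g [b [c [c0 H]]]] := score_fiber a th y k0.
  have [K K0 hK] := exp_quadratic_le g b c0.
  exists (`|f y a 0| * K * (1 + `|b| + 2 * `|c|)) => x.
  rewrite /h /hi /E [upd th a x a 0]mxE eqxx [(0 : 'cV_n) a 0]mxE subr0.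
  have [-> ->] := H x; rewrite !normrM (ger0_norm (expR_ge0 _)).
  have h1 := hK x; have h2 := expR_ge0 (g + b * x + c * x ^+ 2).
  move: (expR _) h1 h2 => e h1 h2.
  have nf := normr_ge0 (f y a 0); have nb := normr_ge0 b; have nc := normr_ge0 c.
  have nx := normr_ge0 x.
  have t1 : `|b + 2 * c * x| <= `|b| + 2 * `|c| * `|x|.
    by apply: le_trans (ler_normD _ _) _; rewrite !normrM (@ger0_norm _ 2).
  have nt := normr_ge0 (b + 2 * c * x).
  split; rewrite -(mulrA `|f y a 0| K) -(mulrA `|f y a 0| (K * _)) -(mulrA K);
    apply: ler_wpM2l => //.
    by apply: (le_trans h1); apply: ler_peMr => //; nra.
  rewrite mulrC; apply: ler_pM => //.
  by apply: (le_trans t1); nra.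
Qed.

(** The weight exp (- kap |th|^2) times the density of N(0, S) is a Gaussian
    weight with - grad log pi = (1/S + 2 kap) th.  The hypothesis holds for each
    th, hence after averaging, and integral_score exchanges A (y - mu) for
    - grad log pi.  Keeping S and kap apart allows several weights to be
    compared under one common law. *)
Lemma bayes_inequality (eps kap : R) : 0 <= eps -> 0 < kap ->
  (forall th, \int[diag_normal d (B *m th)]_y
     (dot (f y) (f y) + 2 * dot (f y) (w th y) + eps)%:E <= 0)%E ->
  let V := fun z : 'cV[R]_n * 'cV[R]_k => expR (- kap * dot z.1 z.1) * L z.1 z.2 *
    (dot (f z.2) (f z.2) + 2 * (S^-1 + 2 * kap) * dot (f z.2) z.1 + eps) in
  (rho \x nu)%E.-integrable setT (EFin \o V) /\
  (\int[(rho \x nu)%E]_z (V z)%:E <= 0)%E.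
Proof.
move=> e0 k0 H V; set c := S^-1 + 2 * kap.
(* the averaged hypothesis; V - J is a combination of the score_comp *)
pose J (z : 'cV[R]_n * 'cV[R]_k) := expR (- kap * dot z.1 z.1) * L z.1 z.2 *
    (dot (f z.2) (f z.2) + 2 * dot (f z.2) (w z.1 z.2) + eps).
have mJ : measurable_fun setT J.
  apply: measurable_funM; first exact: measurable_funM.
  apply: measurable_funD => //; apply: measurable_funD; first exact: measurable_dot.
  by apply: measurable_funM => //; exact: measurable_dot.
have iJ : (rho \x nu)%E.-integrable setT (EFin \o J).
  apply: (@dominated _ (2 + eps)) => //.
  move=> z; apply: env1; first exact: ltW.
  have := dot_ge0 (f z.2 - w z.1 z.2); have := dot_ge0 (f z.2 + w z.1 z.2).
  rewrite !(dotDl, dotDr, dotNl, dotNr) (dotC (w _ _) (f _)).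
  have := dot_ge0 (f z.2); have := dot_ge0 (w z.1 z.2); have := dot_ge0 z.1.
  move: (dot z.1 z.1) (dot (w _ _) (w _ _)) (dot (f _) (f _)) (dot _ _).
  move=> t y x p t0 y0 x0 h1 h2.
  by rewrite ler_norml; apply/andP; split; nra.
have J0 : (\int[(rho \x nu)%E]_z (J z)%:E <= 0)%E.
  rewrite -(integral12_prod_meas1 iJ).
  have mlth th : measurable_fun setT (lik d (B *m th)) by exact: measurable_lik.
  have le0 th : (fubini_F nu (EFin \o J) th <= 0)%E.
    rewrite /fubini_F.
    have mg : measurable_fun setT (fun y => (dot (f y) (f y) + 2 * dot (f y) (w th y) + eps)%:E).
      apply/measurable_EFinP; apply: measurable_funD => //; apply: measurable_funD.
        exact: measurable_dot.
      apply: measurable_funM => //; apply: measurable_dot => //.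
      by apply: measurable_mulmx; exact: measurable_submx.
    have ig : (diag_normal d (B *m th)).-integrable setT
        (fun y => (dot (f y) (f y) + 2 * dot (f y) (w th y) + eps)%:E).
      apply: (@le_integrable _ _ _ _ _ measurableT _
        (fun y => 2%:E * (dot (f y) (f y))%:E + (dot (w th y) (w th y))%:E + eps%:E)%E) => //.
        move=> y _; rewrite -!EFinM -!EFinD /= lee_fin.
        have := dot_ge0 (f y - w th y); have := dot_ge0 (f y + w th y).
        rewrite !(dotDl, dotDr, dotNl, dotNr) (dotC (w _ _) (f _)).
        have := dot_ge0 (f y); have := dot_ge0 (w th y).
        move: (dot (w th y) (w th y)) (dot (f y) (f y)) (dot (f y) (w th y)) => y' x p y0 x0 h1 h2.
        by rewrite (@ger0_norm _ (2 * x + y' + eps)) ?ler_norml; [apply/andP; split|]; nra.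
      apply: integrableD => //; last exact: finite_measure_integrable_cst.
      apply: integrableD => //; last first.
        have [iq _] := diag_normal_qform d_gt0 (B *m th) (A^T *m A).
        by under eq_fun do rewrite -qform_gram.
      apply: integrableZl => //; apply/integrableP; split.
        by apply/measurable_EFinP; exact: measurable_dot.
      under eq_integral do rewrite gee0_abs ?lee_fin ?dot_ge0//.
      by apply: le_lt_trans (fC th) _; rewrite ltry.
    have Hth := H th.
    rewrite (density_integral (fun y => ltW (lik_gt0 d (B *m th) y))
       (diag_normal_density d_gt0 (B *m th)) mg) in Hth.
    have -> : (\int[nu]_y (EFin \o J) (th, y) = \int[nu]_y ((expR (- kap * dot th th))%:E *
       ((dot (f y) (f y) + 2 * dot (f y) (w th y) + eps)%:E * (L th y)%:E)))%E.
      apply: eq_integral => y _; rewrite -!EFinM /J /=; congr (_%:E); ring.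
    rewrite integralZl//; first by rewrite mule_ge0_le0// lee_fin expR_ge0.
    exact: (iffLR (density_integrable (fun y => ltW (lik_gt0 d (B *m th) y))
       (diag_normal_density d_gt0 (B *m th)) (mlth th) mg)).
  by apply: le0_integral => th; exact: le0.
have VE z : (V z)%:E = ((J z)%:E + \sum_a (- 2)%:E * (score_comp kap a z)%:E)%E.
  under eq_bigr do rewrite -EFinM.
  rewrite sumEFin -EFinD; congr (_%:E); rewrite /V /J -/c.
  have -> : \sum_a - 2 * score_comp kap a z = - 2 * (expR (- kap * dot z.1 z.1) * L z.1 z.2 *
      (dot (f z.2) (w z.1 z.2) - c * dot (f z.2) z.1)).
    rewrite -mulr_sumr; congr (_ * _); rewrite /score_comp -mulr_sumr; congr (_ * _).
    rewrite /dot mulr_sumr -sumrB; apply: eq_bigr => a _; rewrite -/c; ring.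
  ring.
have isum : (rho \x nu)%E.-integrable setT
    (fun z => \sum_a (- 2)%:E * (score_comp kap a z)%:E)%E.
  apply: integrable_sum => // a _; apply: integrableZl => //.
  by apply: iscore; exact: ltW.
split.
  rewrite (_ : EFin \o V = fun z => ((J z)%:E + \sum_a (- 2)%:E * (score_comp kap a z)%:E)%E).
    exact: integrableD.
  by apply/funext => z; rewrite -VE.
under eq_integral do rewrite VE.
rewrite integralD// integral_sum//; last first.
  by move=> a; apply: integrableZl => //; apply: iscore; exact: ltW.
rewrite big1 ?adde0// => a _.
by rewrite integralZl ?integral_score ?mule0//; apply: iscore; exact: ltW.
Qed.

End integration_by_parts.

(** * Gaussian weights cannot see a uniform gain *)
Section isotropic_moments.
Context {R : realType} {n : nat}.
Variables (S kap : R).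
Hypotheses (S_gt0 : 0 < S) (kap_ge0 : 0 <= kap).

Local Notation rho S := (diag_normal (const_mx S) (0 : 'cV[R]_n)).
Local Notation K := (Num.sqrt (1 + 2 * kap * S) ^+ n).

Let K_gt0 : 0 < K.
Proof. by rewrite exprn_gt0// sqrtr_gt0 ltr_wpDr// !mulr_ge0// ltW. Qed.

Lemma isotropic_reweight (g : 'cV[R]_n -> \bar R) :
  measurable_fun setT g -> (forall th, 0 <= g th)%E ->
  (\int[rho S]_th (g th * (expR (- kap * dot th th))%:E) =
   (K^-1)%:E * \int[rho (S / (1 + 2 * kap * S))%R]_th g th)%E.
Proof.
move=> mg g0; rewrite [in RHS](isotropic_density S_gt0 kap_ge0 mg g0).
rewrite -ge0_integralZl//; first last.
- by move=> th _; rewrite mule_ge0// lee_fin mulr_ge0 ?expR_ge0// ltW.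
- apply: emeasurable_funM => //; apply/measurable_EFinP; apply: measurable_funM => //.
  apply: measurableT_comp => //; apply: measurable_funM => //.
  exact: measurable_dot.
apply: eq_integral => th _; rewrite muleCA -EFinM mulrA mulVf ?mul1r//.
by rewrite gt_eqF.
Qed.

Lemma isotropic_mass : (\int[rho S]_th (expR (- kap * dot th th))%:E = (K^-1)%:E)%E.
Proof.
transitivity ((K^-1)%:E * \int[rho (S / (1 + 2 * kap * S))%R]__ 1)%E.
  rewrite -isotropic_reweight//; apply: eq_integral => th _; by rewrite mul1e.
by rewrite [X in (_ * X)%E]prob_integral_cst mule1.
Qed.

Lemma isotropic_second_moment (v : R) : 0 < v ->
  (\int[rho v]_th (dot th th)%:E = (n%:R * v)%:E)%E.
Proof.
move=> v0; have v0' i : 0 < (const_mx v : 'rV[R]_n) 0 i by rewrite mxE.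
have [_] := diag_normal_qform v0' 0 1%:M.
under eq_integral do rewrite subr0 qformE mul1mx.
move=> ->; congr (_%:E); under eq_bigr do rewrite !mxE eqxx mulr1.
by rewrite sumr_const card_ord mulr_natl.
Qed.

Lemma isotropic_weighted_moment :
  (\int[rho S]_th (dot th th * expR (- kap * dot th th))%:E =
    (K^-1 * (n%:R * (S / (1 + 2 * kap * S))))%:E)%E.
Proof.
under eq_integral do rewrite EFinM.
rewrite isotropic_reweight ?isotropic_second_moment ?EFinM//.
- by rewrite divr_gt0// ltr_wpDr// !mulr_ge0// ltW.
- by apply/measurable_EFinP; exact: measurable_dot.
- by move=> th; rewrite lee_fin dot_ge0.
Qed.

End isotropic_moments.

Section uniform_gain.
Context {R : realType} {k n : nat}.
Variables (d : 'rV[R]_k) (A : 'M[R]_(n, k)) (f : 'cV[R]_k -> 'cV[R]_n) (C : R).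
Hypotheses (d_gt0 : forall i, 0 < d 0 i) (mf : measurable_fun setT f).

Local Notation B := (slice d A).
Local Notation nu := (diag_normal d 0).
Local Notation rho S := (diag_normal (const_mx S) (0 : 'cV[R]_n)).
Local Notation L th y := (lik d (B *m th) y).
Local Notation w th y := (A *m (y - B *m th)).

Hypothesis fC : forall th,
  (\int[diag_normal d (B *m th)]_y (dot (f y) (f y))%:E <= C%:E)%E.

Lemma measurable_slice_mean (h : 'cV[R]_k -> \bar R) :
  measurable_fun setT h -> (forall y, 0 <= h y)%E ->
  measurable_fun setT (fun th => \int[diag_normal d (B *m th)]_y h y)%E.
Proof.
move=> mh h0.
rewrite (_ : (fun th => _) = fun th => \int[nu]_y (h y * (L th y)%:E))%E; last first.
  by apply/funext => th; exact: (diag_normal_density d_gt0 (B *m th) mh h0).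
apply: (measurable_fun_fubini_tonelli_F (fun z : 'cV[R]_n * 'cV[R]_k =>
  h z.2 * (L z.1 z.2)%:E)%E).
  apply: emeasurable_funM; first exact: (measurableT_comp mh measurable_snd).
  apply/measurable_EFinP.
  by apply: measurable_lik; [apply: measurable_mulmx; exact: measurable_fst|exact: measurable_snd].
by move=> z; rewrite mule_ge0// lee_fin ltW// lik_gt0.
Qed.

Lemma integral_lik_slice (S : R) (g : 'cV[R]_n -> \bar R) (h : 'cV[R]_k -> \bar R) :
  measurable_fun setT g -> (forall th, 0 <= g th)%E ->
  measurable_fun setT h -> (forall y, 0 <= h y)%E ->
  (\int[(rho S \x nu)%E]_z (g z.1 * (h z.2 * (L z.1 z.2)%:E)) =
   \int[rho S]_th (g th * \int[diag_normal d (B *m th)]_y h y))%E.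
Proof.
move=> mg g0 mh h0.
have m2 : measurable_fun setT (fun z : 'cV[R]_n * 'cV[R]_k => h z.2).
  exact: (measurableT_comp mh measurable_snd).
have m1 : measurable_fun setT (fun z : 'cV[R]_n * 'cV[R]_k => g z.1).
  exact: (measurableT_comp mg measurable_fst).
have mL : measurable_fun setT (fun z : 'cV[R]_n * 'cV[R]_k => L z.1 z.2).
  by apply: measurable_lik; [apply: measurable_mulmx; exact: measurable_fst|exact: measurable_snd].
have mLy th : measurable_fun setT (fun y : 'cV[R]_k => L th y) by exact: measurable_lik.
rewrite fubini_tonelli1//.
- apply: eq_integral => th _; rewrite /fubini_F /=.
  transitivity (g th * \int[nu]_y (h y * (L th y)%:E))%E; last first.
    exact: (congr1 (mule (g th)) (esym (diag_normal_density d_gt0 (B *m th) mh h0))).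
  rewrite ge0_integralZl//.
  + by apply: emeasurable_funM => //; exact/measurable_EFinP.
  + by move=> y _; rewrite mule_ge0// lee_fin ltW// lik_gt0.
- apply: emeasurable_funM => //; apply: emeasurable_funM => //; exact/measurable_EFinP.
- by move=> z; rewrite !mule_ge0// lee_fin ltW// lik_gt0.
Qed.

(** Take kap = 1/S, so that c = 1/S + 2 kap = 3/S.  As |f + c th|^2 >= 0, the
    averaged inequality leaves eps times the mass of the weight bounded by c^2
    times its second moment.  The variance under the weight is S/3, whence
    eps <= 9 / S^2 * n S / 3 = 3 n / S for every S. *)
Lemma uniform_gain_le0 (eps : R) : 0 <= eps ->
  (forall th, \int[diag_normal d (B *m th)]_y
     (dot (f y) (f y) + 2 * dot (f y) (w th y) + eps)%:E <= 0)%E ->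
  eps <= 0.
Proof.
move=> e0 H.
have bound S : 0 < S -> eps <= n%:R * (3 / S).
  move=> S0; have k0 : 0 < S^-1 by rewrite invr_gt0.
  have [iV V0] := bayes_inequality d_gt0 mf S0 fC e0 k0 H.
  set V := (X in (_ \x _)%E.-integrable _ (EFin \o X)) in iV V0.
  pose c := S^-1 + 2 * S^-1.
  pose g (th : 'cV[R]_n) := expR (- S^-1 * dot th th).
  pose g2 (th : 'cV[R]_n) := c ^+ 2 * (dot th th * expR (- S^-1 * dot th th)).
  have mdot : measurable_fun setT (fun th : 'cV[R]_n => dot th th) by exact: measurable_dot.
  have mg : measurable_fun setT (fun th => (eps * g th)%:E).
    apply/measurable_EFinP; apply: measurable_funM => //; apply: measurableT_comp => //.
    exact: measurable_funM.
  have mg2 : measurable_fun setT (fun th => (g2 th)%:E).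
    apply/measurable_EFinP; apply: measurable_funM => //; apply: measurable_funM => //.
    by apply: measurableT_comp => //; exact: measurable_funM.
  have g0 th : (0 <= (eps * g th)%:E)%E by rewrite lee_fin mulr_ge0// expR_ge0.
  have g20 th : (0 <= (g2 th)%:E)%E.
    by rewrite lee_fin mulr_ge0 ?sqr_ge0// mulr_ge0 ?expR_ge0// dot_ge0.
  have I1 := integral_lik_slice S mg g0 (measurable_cst 1%E) (fun=> lee01).
  have I2 := integral_lik_slice S mg2 g20 (measurable_cst 1%E) (fun=> lee01).
  have k0' := ltW k0.
  have mass := isotropic_mass (n := n) S0 k0'.
  have moment := isotropic_weighted_moment (n := n) S0 k0'.
  set K := Num.sqrt _ ^+ n in mass moment.
  have K0 : 0 < K.
    by rewrite exprn_gt0// sqrtr_gt0 ltr_wpDr// !mulr_ge0// ltW.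
  have E1 : (\int[(rho S \x nu)%E]_z ((eps * g z.1)%:E * (1 * (L z.1 z.2)%:E)) = (eps * K^-1)%:E)%E.
    rewrite I1; under eq_integral do rewrite prob_integral_cst mule1 EFinM.
    rewrite ge0_integralZl// ?mass//.
    - by apply/measurable_EFinP; apply: measurableT_comp => //; exact: measurable_funM.
    - by move=> th _; rewrite lee_fin expR_ge0.
  have E2 : (\int[(rho S \x nu)%E]_z ((g2 z.1)%:E * (1 * (L z.1 z.2)%:E)) =
      (c ^+ 2 * (K^-1 * (n%:R * (S / (1 + 2 * S^-1 * S)))))%:E)%E.
    rewrite I2; under eq_integral do rewrite prob_integral_cst mule1 /g2 EFinM.
    rewrite ge0_integralZl// ?moment ?lee_fin ?sqr_ge0//.
    - apply/measurable_EFinP; apply: measurable_funM => //.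
      by apply: measurableT_comp => //; exact: measurable_funM.
    - by move=> th _; rewrite lee_fin mulr_ge0 ?dot_ge0// expR_ge0.
  have mL : measurable_fun setT (fun z : 'cV[R]_n * 'cV[R]_k => (1 * (L z.1 z.2)%:E)%E).
    apply: emeasurable_funM => //; apply/measurable_EFinP.
    by apply: measurable_lik; [apply: measurable_mulmx; exact: measurable_fst|exact: measurable_snd].
  have L0 (z : 'cV[R]_n * 'cV[R]_k) : (0 <= 1 * (L z.1 z.2)%:E)%E.
    by rewrite mul1e lee_fin ltW// lik_gt0.
  have ig2 : (rho S \x nu)%E.-integrable setT
     (fun z => (g2 z.1)%:E * (1 * (L z.1 z.2)%:E))%E.
    apply/integrableP; split.
      by apply: emeasurable_funM => //; exact: (measurableT_comp mg2 measurable_fst).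
    rewrite (eq_integral (fun z => (g2 z.1)%:E * (1 * (L z.1 z.2)%:E))%E) ?E2 ?ltry// => z _.
    by rewrite gee0_abs//; exact: mule_ge0.
  have ig1 : (rho S \x nu)%E.-integrable setT
     (fun z => (eps * g z.1)%:E * (1 * (L z.1 z.2)%:E))%E.
    apply/integrableP; split.
      by apply: emeasurable_funM => //; exact: (measurableT_comp mg measurable_fst).
    rewrite (eq_integral (fun z => (eps * g z.1)%:E * (1 * (L z.1 z.2)%:E))%E) ?E1 ?ltry// => z _.
    by rewrite gee0_abs//; exact: mule_ge0.
  have le1 : ((eps * K^-1)%:E <= (c ^+ 2 * (K^-1 * (n%:R * (S / (1 + 2 * S^-1 * S)))))%:E)%E.
    rewrite -E1 -E2.
    apply: (@le_trans _ _ (\int[(rho S \x nu)%E]_z ((V z)%:E +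
       (g2 z.1)%:E * (1 * (L z.1 z.2)%:E)))%E).
      apply: le_integral => //; first exact: integrableD.
      move=> z _; rewrite !mul1e -!EFinM -EFinD lee_fin /V /g /g2 -/c.
      have := dot_ge0 (f z.2 + c *: z.1).
      rewrite !(dotDl, dotDr, dotZl, dotZr) (dotC z.1 (f _)) => h.
      have := mulr_ge0 (mulr_ge0 (expR_ge0 (- S^-1 * dot z.1 z.1)) (ltW (lik_gt0 d (B *m z.1) z.2))) h.
      move: (expR (- S^-1 * dot z.1 z.1)) (lik d (B *m z.1) z.2).
      move: (dot (f z.2) (f z.2)) (dot (f z.2) z.1) (dot z.1 z.1) => x y t e l.
      by lra.
    rewrite integralD//; apply: (@le_trans _ _ (0 + _)%E); last by rewrite add0e.
    exact: leeD.
  move: le1; rewrite lee_fin.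
  have -> : c ^+ 2 * (K^-1 * (n%:R * (S / (1 + 2 * S^-1 * S)))) = n%:R * (3 / S) * K^-1.
    by rewrite /c; field; rewrite !gt_eqF.
  by rewrite ler_pM2r// invr_gt0.
rewrite leNgt; apply/negP => e1.
have S0 : 0 < n%:R * 6 / eps + 1 by rewrite ltr_wpDl// divr_ge0// mulr_ge0.
have := bound _ S0; rewrite mulrA ler_pdivlMr// mulrDr mulr1 mulrC divfK ?gt_eqF//.
have n0 : 0 <= n%:R :> R by [].
by move: (n%:R) n0 => n' n0 h; nra.
Qed.

End uniform_gain.

(** * Blyth's method in the plane *)
Section scales.
Context {R : realType}.

(** Gaussians at the widely separated scales N^j and N^l have nearly orthogonal
    gradients in the plane: the inner product is proportional to this ratio. *)
Lemma scale_ratio_le (N : nat) (j l : nat) : (0 < N)%N ->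
  (N%:R ^+ j * N%:R ^+ l) / (N%:R ^+ j + N%:R ^+ l) ^+ 2 <=
   (j == l)%:R + N%:R^-1 :> R.
Proof.
move=> N0; have N1 : 0 < N%:R :> R by rewrite ltr0n.
have Ni : 0 < N%:R^-1 :> R by rewrite invr_gt0.
have p i : 0 < N%:R ^+ i :> R by rewrite exprn_gt0.
have H i e : (i < e)%N -> (N%:R ^+ i * N%:R ^+ e) / (N%:R ^+ i + N%:R ^+ e) ^+ 2 <= N%:R^-1 :> R.
  move=> ie; have -> : N%:R ^+ i = N%:R ^+ e * N%:R ^- (e - i) :> R.
    by rewrite -[X in N%:R ^+ X * _](subnK (ltnW ie)) exprD mulrAC mulfV ?mul1r// expf_neq0 ?gt_eqF.
  have q0 : 0 < N%:R ^- (e - i) :> R by rewrite invr_gt0.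
  have q1 : N%:R ^- (e - i) <= N%:R^-1 :> R.
    rewrite lef_pV2 ?posrE// -[leLHS]expr1 ler_weXn2l ?ler1n// subn_gt0//.
  have := p e; move: (N%:R ^+ e) (N%:R ^- (e - i)) q0 q1 => x q q0 q1 x0.
  have -> : x * q * x / (x * q + x) ^+ 2 = q / (1 + q) ^+ 2.
    by field; rewrite !gt_eqF// ?addr_gt0// ?mulr_gt0.
  apply: le_trans q1; rewrite ler_pdivrMr ?exprn_gt0 ?addr_gt0//.
  by rewrite ler_peMr ?ltW//; nra.
have [jl|lj|->] := ltngtP j l; rewrite ?add0r; [exact: H| |].
- by rewrite (mulrC (N%:R ^+ j)) (addrC (N%:R ^+ j)); exact: H.
- rewrite ler_wpDr ?ltW//; have := p l; move: (N%:R ^+ l) => x x0.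
  by rewrite ltr_pdivrMr ?exprn_gt0 ?addr_gt0// mul1r; nra.
Qed.

End scales.

Section two_dimensions.
Context {R : realType} {k : nat}.
Local Notation n := 2%N.
Variables (d : 'rV[R]_k) (A : 'M[R]_(n, k)) (f : 'cV[R]_k -> 'cV[R]_n) (C : R).
Hypotheses (d_gt0 : forall i, 0 < d 0 i) (mf : measurable_fun setT f).

Local Notation B := (slice d A).
Local Notation nu := (diag_normal d 0).
Local Notation rho S := (diag_normal (const_mx S) (0 : 'cV[R]_n)).
Local Notation L th y := (lik d (B *m th) y).
Local Notation w th y := (A *m (y - B *m th)).

Hypothesis fC : forall th,
  (\int[diag_normal d (B *m th)]_y (dot (f y) (f y))%:E <= C%:E)%E.
Hypothesis H : forall th, (\int[diag_normal d (B *m th)]_y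
     (dot (f y) (f y) + 2 * dot (f y) (w th y) + 0)%:E <= 0)%E.

Let F th := (\int[diag_normal d (B *m th)]_y (dot (f y) (f y))%:E)%E.

(** Let u(th) be the sum over j < N of exp (- |th|^2 / (2 s_j)), s_j = N^j.  The
    weight u^2 is a sum of Gaussian weights, one for each pair (j, l), so
    bayes_inequality applies to each, and the sum over pairs reads
      int E_th [ u^2 |f|^2 - 4 u f . grad u ] dth <= 0.
    Since |u f - 4 grad u|^2 >= 0, half of the first term is at most
    8 int |grad u|^2.  By scale_ratio_le the N diagonal terms of the energy are
    O(1) and the N^2 others O(1/N), so the energy is O(N), while
    u^2 >= N^2 exp (- |th|^2). *)
Lemma blyth_bound (N : nat) : (0 < N)%N ->
  (\int[rho (2^-1)%R]_th F th <= (128 / N%:R)%:E)%E.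
Proof.
move=> N0; have N1 : 0 < N%:R :> R by rewrite ltr0n.
(* a scale beyond all the s j, so that every weight is a bounded reweighting of
   the one law rho S *)
pose S : R := N%:R ^+ N.
pose s (j : 'I_N) : R := N%:R ^+ j.
have S0 : 0 < S by rewrite exprn_gt0.
have s0 j : 0 < s j by rewrite exprn_gt0.
have s1 j : 1 <= s j by rewrite exprn_ege1// ler1n.
have sS j : s j <= S by rewrite /s /S ler_weXn2l ?ler1n// ltnW.
have S1 : 1 <= S by rewrite exprn_ege1// ler1n.
(* the product of two weights carries one factor exp (- |th|^2 / (2 S)) from
   rho S; each of the two gives back half of it, and the pair (j, l) has
   1/S + 2 (kap j + kap l) = 1 / s j + 1 / s l *)
pose kap j := (2 * s j)^-1 - (4 * S)^-1.
have kap_gt0 j : 0 < kap j.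
  rewrite subr_gt0 ltf_pV2 ?posrE ?mulr_gt0//.
  by have := s0 j; have := sS j; lra.
(* the rate of the narrowest weight, s = 1 *)
pose kap0 : R := 2^-1 - (4 * S)^-1.
have kap_le j : kap j <= kap0.
  by rewrite lerD2r lef_pV2 ?posrE ?mulr_gt0// ler_peMr.
(* Phi is u up to the normalization by rho S, and - th Xi its gradient *)
pose phi j (th : 'cV[R]_n) := expR (- kap j * dot th th).
pose Phi th := \sum_j phi j th.
pose Xi th := \sum_j phi j th / s j.
pose V j l (z : 'cV[R]_n * 'cV[R]_k) := expR (- (kap j + kap l) * dot z.1 z.1) * L z.1 z.2 *
    (dot (f z.2) (f z.2) + 2 * (S^-1 + 2 * (kap j + kap l)) * dot (f z.2) z.1 + 0).
have VH j l := bayes_inequality d_gt0 mf S0 fC (lexx 0) (addr_gt0 (kap_gt0 j) (kap_gt0 l)) H.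
have VE z : \sum_j \sum_l V j l z = L z.1 z.2 * (dot (f z.2) (f z.2) * Phi z.1 ^+ 2 +
    4 * Phi z.1 * Xi z.1 * dot (f z.2) z.1).
  have -> : Phi z.1 ^+ 2 = \sum_j \sum_l phi j z.1 * phi l z.1.
    by rewrite expr2 /Phi big_distrlr.
  have -> : 4 * Phi z.1 * Xi z.1 * dot (f z.2) z.1 = \sum_j \sum_l
     (phi j z.1 * phi l z.1 * (2 * ((s j)^-1 + (s l)^-1)) * dot (f z.2) z.1).
    have E1 : Phi z.1 * Xi z.1 = \sum_j \sum_l phi j z.1 * phi l z.1 * (s l)^-1.
      rewrite /Phi /Xi big_distrlr; apply: eq_bigr => j _; apply: eq_bigr => l _ /=; ring.
    have E2 : Phi z.1 * Xi z.1 = \sum_j \sum_l phi j z.1 * phi l z.1 * (s j)^-1.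
      rewrite E1 exchange_big; apply: eq_bigr => j _; apply: eq_bigr => l _; ring.
    have -> : 4 * Phi z.1 * Xi z.1 * dot (f z.2) z.1 =
       2 * dot (f z.2) z.1 * (Phi z.1 * Xi z.1 + Phi z.1 * Xi z.1) by ring.
    rewrite {1}E1 E2 -big_split mulr_sumr; apply: eq_bigr => j _ /=.
    rewrite -big_split mulr_sumr; apply: eq_bigr => l _ /=; ring.
  rewrite mulr_sumr -big_split mulr_sumr; apply: eq_bigr => j _ /=.
  rewrite mulr_sumr -big_split mulr_sumr; apply: eq_bigr => l _ /=.
  rewrite /V /phi -expRD -mulrDl -opprD.
  have -> : S^-1 + 2 * (kap j + kap l) = (s j)^-1 + (s l)^-1.
    by rewrite /kap; field; rewrite !gt_eqF.
  ring.
pose VS z := \sum_j \sum_l V j l z.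
have iVS : (rho S \x nu)%E.-integrable setT (fun z => (VS z)%:E).
  rewrite (_ : (fun z => _) = fun z => (\sum_j \sum_l (V j l z)%:E)%E).
    by apply: integrable_sum => // j _; apply: integrable_sum => // l _; case: (VH j l).
  by apply/funext => z; rewrite -sumEFin; apply: eq_bigr => j _; rewrite -sumEFin.
have VS0 : (\int[(rho S \x nu)%E]_z (VS z)%:E <= 0)%E.
  rewrite (eq_integral (fun z => \sum_j \sum_l (V j l z)%:E)%E); last first.
    by move=> z _; rewrite -sumEFin; apply: eq_bigr => j _; rewrite -sumEFin.
  rewrite integral_sum//; last first.
    by move=> j; apply: integrable_sum => // l _; case: (VH j l).
  apply: sume_le0 => j _; rewrite integral_sum//; last by move=> l; case: (VH j l).
  by apply: sume_le0 => l _; case: (VH j l).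
have mdot : measurable_fun setT (fun th : 'cV[R]_n => dot th th) by exact: measurable_dot.
have mphi a : measurable_fun setT (fun th : 'cV[R]_n => expR (- a * dot th th)).
  by apply: measurableT_comp => //; exact: measurable_funM.
have mXi : measurable_fun setT Xi.
  by apply: measurable_sum => j; apply: measurable_funM => //; exact: mphi.
(* the remainder after completing the square in 1/2 |Phi f + 4 Xi th|^2 *)
pose g th := 8 * (dot th th * Xi th ^+ 2).
have mg : measurable_fun setT (fun th => (g th)%:E).
  apply/measurable_EFinP; apply: measurable_funM => //; apply: measurable_funM => //.
  exact: measurable_funX.
have g0 th : (0 <= (g th)%:E)%E.
  by rewrite lee_fin; apply: mulr_ge0 => //; apply: mulr_ge0; [exact: dot_ge0|exact: sqr_ge0].
have gint : (\int[rho S]_th (g th)%:E <= (32 * N%:R / S)%:E)%E.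
  pose t j l (th : 'cV[R]_n) := ((8 / (s j * s l))%:E *
    (dot th th * expR (- (kap j + kap l) * dot th th))%:E)%E.
  have mt j l : measurable_fun setT
      (fun th : 'cV[R]_n => (dot th th * expR (- (kap j + kap l) * dot th th))%:E).
    by apply/measurable_EFinP; exact: measurable_funM.
  have t0 j l th : (0 <= t j l th)%E.
    by rewrite /t -EFinM lee_fin mulr_ge0 ?divr_ge0 ?mulr_ge0 ?dot_ge0 ?expR_ge0// ltW.
  have gE th : (g th)%:E = (\sum_j \sum_l t j l th)%E.
    under eq_bigr do rewrite sumEFin.
    rewrite sumEFin; congr (_%:E); rewrite /g expr2 /Xi big_distrlr !mulr_sumr.
    apply: eq_bigr => j _; rewrite /= !mulr_sumr; apply: eq_bigr => l _.
    by rewrite /phi (opprD (kap j)) (mulrDl (- kap j)) expRD; field; rewrite !gt_eqF.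
  have tint j l : (\int[rho S]_th t j l th <= (16 / S * ((j == l)%:R + N%:R^-1))%:E)%E.
    rewrite ge0_integralZl//; first last.
    - by rewrite lee_fin divr_ge0// mulr_ge0// ltW.
    - by move=> th _; rewrite lee_fin mulr_ge0 ?dot_ge0// expR_ge0.
    have kk : 0 <= kap j + kap l by rewrite addr_ge0// ltW.
    rewrite (isotropic_weighted_moment S0 kk) -EFinM lee_fin.
    have c0 : 0 < 1 + 2 * (kap j + kap l) * S by rewrite ltr_wpDr// !mulr_ge0// ltW.
    rewrite sqr_sqrtr; last exact: ltW.
    have -> : 1 + 2 * (kap j + kap l) * S = S * (s j + s l) / (s j * s l).
      by rewrite /kap; field; rewrite !gt_eqF.
    have -> : 8 / (s j * s l) * ((S * (s j + s l) / (s j * s l))^-1 *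
       (2%:R * (S / (S * (s j + s l) / (s j * s l))))) =
       16 / S * (s j * s l / (s j + s l) ^+ 2).
      by field; rewrite !gt_eqF// addr_gt0.
    rewrite ler_wpM2l//; first by rewrite divr_ge0// ltW.
    exact: scale_ratio_le.
  have mtt j l : measurable_fun setT (t j l) by exact: measurable_funeM.
  rewrite (eq_integral _ _ (fun th _ => gE th)).
  rewrite ge0_integral_sum//; first last.
  - by move=> j th _; apply: sume_ge0.
  - by move=> j; apply: emeasurable_sum.
  apply: (@le_trans _ _ (\sum_(j < N) \sum_(l < N) (16 / S * ((j == l)%:R + N%:R^-1))%:E)%E).
    apply: lee_sum => j _; rewrite ge0_integral_sum//.
    by apply: lee_sum => l _; exact: tint.
  under eq_bigr do rewrite sumEFin.
  rewrite sumEFin lee_fin.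
  under eq_bigr => j _.
    rewrite -mulr_sumr big_split /= (bigD1 j)//= eqxx big1 ?addr0; last first.
      by move=> l /negbTE; rewrite eq_sym => ->.
    rewrite sumr_const card_ord -[_ *+ N]mulr_natl mulfV ?gt_eqF//.
    over.
  rewrite sumr_const card_ord -[_ *+ N]mulr_natl le_eqVlt; apply/orP; left; apply/eqP.
  rewrite [true%:R]mulr1n; by field; rewrite gt_eqF.
have mff : measurable_fun setT (fun y => (dot (f y) (f y))%:E).
  by apply/measurable_EFinP; exact: measurable_dot.
have ff0 y : (0 <= (dot (f y) (f y))%:E)%E by rewrite lee_fin dot_ge0.
pose e0 (th : 'cV[R]_n) := expR (- (2 * kap0) * dot th th).
have mp : measurable_fun setT (fun th => (N%:R ^+ 2 / 2 * e0 th)%:E).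
  by apply/measurable_EFinP; apply: measurable_funM => //; exact: mphi.
have p0 th : (0 <= (N%:R ^+ 2 / 2 * e0 th)%:E)%E.
  by rewrite lee_fin mulr_ge0 ?expR_ge0// divr_ge0// sqr_ge0.
have mL : measurable_fun setT (fun z : 'cV[R]_n * 'cV[R]_k => (L z.1 z.2)%:E).
  apply/measurable_EFinP.
  by apply: measurable_lik; [apply: measurable_mulmx; exact: measurable_fst|exact: measurable_snd].
have L0 (z : 'cV[R]_n * 'cV[R]_k) : 0 <= L z.1 z.2 by rewrite ltW// lik_gt0.
have IX := integral_lik_slice A d_gt0 S mp p0 mff ff0.
have IY := integral_lik_slice A d_gt0 S mg g0 (measurable_cst 1%E) (fun=> lee01).
have IY' : (\int[(rho S \x nu)%E]_z ((g z.1)%:E * (1 * (L z.1 z.2)%:E)) <= (32 * N%:R / S)%:E)%E.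
  rewrite IY; apply: le_trans gint; rewrite le_eqVlt; apply/orP; left; apply/eqP.
  by apply: eq_integral => th _; rewrite prob_integral_cst mule1.
have mY : measurable_fun setT (fun z : 'cV[R]_n * 'cV[R]_k => ((g z.1)%:E * (1 * (L z.1 z.2)%:E))%E).
  apply: emeasurable_funM; first exact: (measurableT_comp mg measurable_fst).
  exact: emeasurable_funM.
have iY : (rho S \x nu)%E.-integrable setT
    (fun z => (g z.1)%:E * (1 * (L z.1 z.2)%:E))%E.
  apply/integrableP; split => //.
  rewrite (eq_integral (fun z => (g z.1)%:E * (1 * (L z.1 z.2)%:E))%E).
    by apply: le_lt_trans IY' _; rewrite ltry.
  by move=> z _; rewrite gee0_abs// mul1e mule_ge0// lee_fin.
have Phi_ge th : N%:R ^+ 2 * e0 th <= Phi th ^+ 2.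
  have h : N%:R * expR (- kap0 * dot th th) <= Phi th.
    rewrite -[X in X%:R](card_ord N) -sum1_card natr_sum mulr_suml.
    apply: ler_sum => j _; rewrite mul1r ler_expR ler_wpM2r ?dot_ge0// lerN2.
    exact: kap_le.
  have -> : N%:R ^+ 2 * e0 th = (N%:R * expR (- kap0 * dot th th)) ^+ 2.
    rewrite exprMn /e0; congr (_ * _); rewrite expr2 -expRD; congr expR; ring.
  by rewrite ler_sqr ?nnegrE// ?(le_trans _ h)// mulr_ge0// expR_ge0.
have XY : (\int[rho S]_th ((N%:R ^+ 2 / 2 * e0 th)%:E * F th) <= (32 * N%:R / S)%:E)%E.
  rewrite -IX; apply: le_trans IY'.
  apply: (@le_trans _ _ (\int[(rho S \x nu)%E]_z ((VS z)%:E +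
       (g z.1)%:E * (1 * (L z.1 z.2)%:E)))%E); last first.
    rewrite integralD//; apply: (@le_trans _ _ (0 + _)%E); last by rewrite add0e.
    exact: leeD.
  apply: ge0_le_integral => //.
  - by move=> z _; rewrite !mule_ge0// lee_fin.
  - apply: emeasurable_funM; first exact: (measurableT_comp mp measurable_fst).
    by apply: emeasurable_funM => //; exact: (measurableT_comp mff measurable_snd).
  - by apply: emeasurable_funD => //; exact: (measurable_int _ iVS).
  move=> z _; rewrite mul1e -!EFinM -EFinD lee_fin /VS VE /g.
  have := dot_ge0 (Phi z.1 *: f z.2 + (4 * Xi z.1) *: z.1).
  rewrite !(dotDl, dotDr, dotZl, dotZr) (dotC z.1 (f _)) => h1.
  have h2 := ler_wpM2l (dot_ge0 (f z.2)) (Phi_ge z.1).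
  have h3 := mulr_ge0 (L0 z) h1.
  have h4 := ler_wpM2l (L0 z) h2.
  move: (lik d (B *m z.1) z.2) (dot (f z.2) (f z.2)) (dot (f z.2) z.1) (dot z.1 z.1) h3 h4.
  move: (e0 z.1) (Phi z.1) (Xi z.1) => e ph xi l x y t h3 h4.
  by move: (N%:R ^+ 2) h3 h4 => N2 h3 h4; lra.
have mF : measurable_fun setT F by exact: measurable_slice_mean.
have F0 th : (0 <= F th)%E by exact: integral_ge0.
have kap00 : 0 <= 2 * kap0.
  by rewrite mulr_ge0// subr_ge0 lef_pV2 ?posrE ?mulr_gt0//; lra.
have RW := isotropic_reweight (n := n) S0 kap00 mF F0.
have cE : 1 + 2 * (2 * kap0) * S = 2 * S.
  by rewrite /kap0; field; rewrite gt_eqF.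
rewrite cE in RW.
(* rho S reweighted by exp (- 2 kap0 |th|^2) has variance 1/2 for every N *)
have SE : S / (2 * S) = 2^-1 by field; rewrite gt_eqF.
rewrite SE sqr_sqrtr in RW; last by rewrite mulr_ge0// ltW.
have : ((N%:R ^+ 2 / 2)%:E * ((2 * S)^-1%:E * \int[rho (2^-1)%R]_th F th) <= (32 * N%:R / S)%:E)%E.
  rewrite -RW -ge0_integralZl//; first last.
  - by move=> th _; rewrite mule_ge0// lee_fin expR_ge0.
  - by apply: emeasurable_funM => //; apply/measurable_EFinP; exact: mphi.
  apply: le_trans XY; rewrite le_eqVlt; apply/orP; left; apply/eqP.
  by apply: eq_integral => th _; rewrite [in RHS]EFinM -[RHS]muleA (muleC (F th)).
rewrite muleA -EFinM.
have cc : 0 < N%:R ^+ 2 / 2 / (2 * S) by rewrite !divr_gt0 ?mulr_gt0 ?exprn_gt0.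
rewrite -lee_pdivlMl// => /le_trans; apply; rewrite -EFinM lee_fin le_eqVlt; apply/orP; left.
by apply/eqP; field; rewrite !gt_eqF.
Qed.

(** The left-hand side of blyth_bound does not depend on N, so it vanishes and
    F th = 0 for some th.  All the laws N(mu, D) have the same null sets, so
    f = 0 almost everywhere for each of them. *)
Lemma dominating_gap_eq0 mu :
  (\int[diag_normal d mu]_y (dot (f y) (f y))%:E = 0)%E.
Proof.
have mff : measurable_fun setT (fun y => (dot (f y) (f y))%:E).
  by apply/measurable_EFinP; exact: measurable_dot.
have ff0 y : (0 <= (dot (f y) (f y))%:E)%E by rewrite lee_fin dot_ge0.
have F0 th : (0 <= F th)%E by exact: integral_ge0.
have mLmu m : measurable_fun setT (fun y => (lik d m y)%:E).
  by apply/measurable_EFinP; exact: measurable_lik.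
have mF : measurable_fun setT F by exact: measurable_slice_mean.
have Z0 : (\int[rho (2^-1)%R]_th F th = 0)%E.
  apply/eqP; rewrite eq_le integral_ge0// andbT; apply/lee_addgt0Pr => e e0.
  rewrite add0e; pose N := (Num.truncn (128 / e)).+1.
  have N1 : 0 < N%:R :> R by rewrite ltr0n.
  apply: le_trans (@blyth_bound N isT) _; rewrite lee_fin ler_pdivrMr// mulrC -ler_pdivrMr//.
  exact/ltW/truncnS_gt.
have [th Fth] := prob_integral_eq0_ex mF F0 Z0.
have m2 m : measurable_fun setT (fun y => (dot (f y) (f y))%:E * (lik d m y)%:E)%E.
  exact: emeasurable_funM.
have ge0 m y : (0 <= (dot (f y) (f y))%:E * (lik d m y)%:E)%E.
  by rewrite mule_ge0// lee_fin ltW// lik_gt0.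
apply: etrans (diag_normal_density d_gt0 mu mff ff0) _.
rewrite -(integral0 nu setT).
apply: ae_eq_integral; [exact: measurableT|exact: m2|exact: measurable_cst|].
have Z1 : (\int[nu]_y `|(dot (f y) (f y))%:E * (L th y)%:E| = 0)%E.
  apply: etrans _ Fth; apply/esym.
  apply: etrans (diag_normal_density d_gt0 (B *m th) mff ff0) _.
  by apply: eq_integral => y _; rewrite gee0_abs.
have /iffLR/(_ Z1) := ae_eq_integral_abs nu measurableT (m2 (B *m th)).
apply: filterS => y /= /(_ I) h _.
move/eqP: h; rewrite -EFinM eqe mulf_eq0 (gt_eqF (lik_gt0 _ _ _)) orbF => /eqP ->.
by rewrite mul0e.
Qed.

End two_dimensions.

(** * Shrinkage for a degenerate loss *)
Section james_stein.
Context {R : realType} {k : nat}.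
Variables (d : 'rV[R]_k) (M K : 'M[R]_k) (r : nat).
Hypotheses (d_gt0 : forall i, 0 < d 0 i) (psdM : psdmx M).
Hypotheses (KDMK : K *m (diag_mx d *m M) *m K = K)
  (trK : \tr (diag_mx d *m M *m K) = r%:R) (r_ge3 : (3 <= r)%N).

Local Notation N := (M *m K).
Local Notation G := (K^T *m M *m K).

(** For D = M = K = 1 this is y - y / (|y|^2 + 1), a smoothed James-Stein
    estimator.  In general K undoes D M, which makes the divergence below depend
    on y through qform M (K y) alone. *)
Definition shrink (y : 'cV[R]_k) : 'cV[R]_k := y - (qform M (K *m y) + 1)^-1 *: (K *m y).

Let q (y : 'cV[R]_k) := qform M (K *m y).

Let psdG : psdmx G.
Proof.
have [sM pM] := psdM; split; first by rewrite !trmx_mul trmxK sM mulmxA.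
by move=> v; rewrite qformE -!mulmxA dot_mul trmxK -qformE.
Qed.

Let qG y : q y = qform G y.
Proof. by rewrite /q !qformE -!mulmxA (dot_mul K^T) trmxK. Qed.

Let q_ge0 y : 0 <= q y. Proof. exact: psdM.2. Qed.
Let q1 y : 0 < q y + 1. Proof. by rewrite ltr_wpDl. Qed.

Let sqr_coor (X : 'M[R]_k) (v : 'cV[R]_k) i : psdmx X ->
  ((X *m v) i 0) ^+ 2 <= X i i * qform X v.
Proof.
move=> pX; have := psd_cauchy (delta_mx i 0) v pX.
have dE (w : 'cV[R]_k) : dot (delta_mx i 0) w = w i 0.
  rewrite /dot (bigD1 i)//= big1 => [|j ji]; rewrite !mxE ?eqxx ?mul1r ?addr0//.
  by rewrite (negbTE ji) mul0r.
rewrite dE qformE dE.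
suff -> : (X *m delta_mx i 0 : 'cV_k) i 0 = X i i by [].
by rewrite -colE mxE.
Qed.

Let diag_ge0 (X : 'M[R]_k) i : psdmx X -> 0 <= X i i.
Proof.
move=> [_ pX]; have := pX (delta_mx i 0); rewrite qformE -colE /dot (bigD1 i)//= big1.
  by rewrite !mxE !eqxx mul1r addr0.
by move=> j ji; rewrite !mxE (negbTE ji) mul0r.
Qed.

(* the vector field - M K y / (q + 1), and its i-th partial derivative in y_i *)
Let H i y := - ((N *m y) i 0 / (q y + 1)).
Let H' i y := - (N i i / (q y + 1) - 2 * (N *m y) i 0 * (G *m y) i 0 / (q y + 1) ^+ 2).

(* KDMK = K gives G D M K = G, and the trace gives the dimension r *)
Let div_sum y : \sum_i d 0 i * H' i y = - (r%:R / (q y + 1) - 2 * q y / (q y + 1) ^+ 2).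
Proof.
have t1 : \sum_i d 0 i * N i i = r%:R.
  by rewrite -trK /mxtrace; apply: eq_bigr => i _; rewrite -mulmxA mul_diag_mx [RHS]mxE.
have t2 : \sum_i d 0 i * ((N *m y) i 0 * (G *m y) i 0) = q y.
  transitivity (dot (G *m y) (diag_mx d *m (N *m y))).
    by apply: eq_bigr => i _; rewrite mul_diag_mx [X in _ = _ * X]mxE; ring.
  have sG := psdG.1.
  have GE : G *m diag_mx d *m N = G.
    transitivity (K^T *m M *m (K *m (diag_mx d *m M) *m K)); first by rewrite !mulmxA.
    by rewrite KDMK.
  by rewrite -{1}sG -dot_mul (mulmxA G) (mulmxA (G *m _)) GE qG qformE.
rewrite -t1 -{2}t2 /H'.
rewrite !mulr_sumr !mulr_suml -sumrB -sumrN; apply: eq_bigr => i _.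
by field; rewrite gt_eqF.
Qed.

Let q_upd v i x : q (upd v i x) = q (upd v i 0) + 2 * (G *m upd v i 0) i 0 * x + G i i * x ^+ 2.
Proof.
have -> : upd v i x = upd v i 0 + x *: delta_mx i 0.
  apply/matrixP => j l; rewrite [l]ord1 !mxE; case: eqP => _; first by rewrite add0r mulr1.
  by rewrite mulr0 addr0.
have dE (w : 'cV[R]_k) : dot (delta_mx i 0) w = w i 0.
  rewrite /dot (bigD1 i)//= big1 => [|j ji]; rewrite !mxE ?eqxx ?mul1r ?addr0//.
  by rewrite (negbTE ji) mul0r.
rewrite !qG qformD ?(psdG.1)// qformZ [qform G (delta_mx _ _)]qformE dotZl !dE.
have -> : (G *m delta_mx i 0 : 'cV_k) i 0 = G i i by rewrite -colE mxE.
ring.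
Qed.

Let dH v i x : is_derive x (1 : R) (fun z => H i (upd v i z)) (H' i (upd v i x)).
Proof.
pose a := (N *m upd v i 0) i 0.
pose den (z : R) := (q (upd v i 0) + 1) + 2 * (G *m upd v i 0) i 0 * z + G i i * z ^+ 2.
have denE z : den z = q (upd v i z) + 1 by rewrite q_upd /den; ring.
have -> : (fun z => H i (upd v i z)) =
    (fun z => - a + (- N i i) * z + 0 * z ^+ 2) * (fun z => (den z)^-1).
  apply/funext => z; transitivity ((- a + (- N i i) * z + 0 * z ^+ 2) * (den z)^-1) => //.
  by rewrite /H denE upd_mul -/a; ring.
have h1 := is_derive_quadratic (- a) (- N i i) 0 x.
have den0 : den x != 0 by rewrite denE gt_eqF.
have h2 := is_deriveV den0 (is_derive_quadratic (q (upd v i 0) + 1) (2 * (G *m upd v i 0) i 0) (G i i) x).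
apply: (is_derive_eq (is_deriveM h1 h2)).
rewrite /GRing.scale /= /H' -denE (upd_mul N v i x) (upd_mul G v i x) -/a.
by field.
Qed.

Let cH' v i : continuous (fun z => H' i (upd v i z)).
Proof.
pose a := (N *m upd v i 0) i 0.
pose g0 := (G *m upd v i 0) i 0.
pose den (z : R) := (q (upd v i 0) + 1) + 2 * g0 * z + G i i * z ^+ 2.
have denE z : den z = q (upd v i z) + 1 by rewrite q_upd /den /g0; ring.
have cden : continuous (fun z => (den z)^-1).
  move=> z; apply: cvgV; first by rewrite denE gt_eqF.
  exact: (is_derive_continuous (is_derive_quadratic _ _ _)).
have -> : (fun z => H' i (upd v i z)) = (fun z => - N i i * (den z)^-1 +
   (2 * (a + N i i * z)) * ((g0 + G i i * z) * ((den z)^-1 * (den z)^-1))).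
  apply/funext => z; rewrite /H' -denE (upd_mul N v i z) (upd_mul G v i z) -/a -/g0.
  by have : den z != 0 by [rewrite denE gt_eqF]; move=> den0; field.
have clin (b c : R) : continuous (fun z : R => b + c * z).
  by move=> z; apply: cvgD; [exact: cvg_cst|apply: cvgM; [exact: cvg_cst|exact: cvg_id]].
move=> z; apply: cvgD; first by apply: cvgM; [exact: cvg_cst|exact: cden].
apply: cvgM; first by apply: cvgM; [exact: cvg_cst|exact: clin].
by apply: cvgM; [exact: clin|apply: cvgM; exact: cden].
Qed.

(* by Cauchy-Schwarz (M K y)_i and (G y)_i are O(sqrt q), at most the
   denominators *)
Let boundH i : exists2 C, 0 <= C & forall y, `|H i y| <= C /\ `|H' i y| <= C.
Proof.
have Mii := diag_ge0 i psdM; have Gii := diag_ge0 i psdG.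
exists (1 + M i i + `|N i i| + G i i); first by rewrite !addr_ge0.
move=> y; have hN : (N *m y) i 0 ^+ 2 <= M i i * q y by rewrite -mulmxA; exact: sqr_coor.
have hG : (G *m y) i 0 ^+ 2 <= G i i * q y by rewrite qG; exact: sqr_coor.
have q0 := q_ge0 y; rewrite /H /H'.
have nN := normr_ge0 (N i i).
move: (q y) (q1 y) ((N *m y) i 0) ((G *m y) i 0) hN hG q0 => x x1 a b ha hb x0.
have y1 : 1 <= x + 1 by lra.
have i0 : 0 < (x + 1)^-1 by rewrite invr_gt0.
have i1 : (x + 1)^-1 <= 1 by rewrite invf_le1.
split.
  rewrite normrN normrM (ger0_norm (ltW i0)).
  rewrite ler_pdivrMr//.
  have h : `|a| ^+ 2 <= M i i * x by rewrite real_normK ?num_real.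
  have na := normr_ge0 a; move: `|a| `|N i i| h na nN => u n' h u0 n0.
  have : 2 * u <= 1 + u ^+ 2 by have := sqr_ge0 (u - 1); lra.
  by have := mulr_ge0 Mii x0; have := mulr_ge0 n0 x0; have := mulr_ge0 Gii x0; nra.
rewrite normrN; apply: le_trans (ler_normB _ _) _.
have e1 : `|N i i / (x + 1)| <= `|N i i|.
  by rewrite normrM (ger0_norm (ltW i0)) ler_piMr.
suff e2 : `|2 * a * b / (x + 1) ^+ 2| <= M i i + G i i by lra.
rewrite normrM [X in _ * X]ger0_norm ?invr_ge0 ?sqr_ge0// ler_pdivrMr ?exprn_gt0//.
have : `|2 * a * b| <= (M i i + G i i) * x.
  have := sqr_ge0 (a + b); have := sqr_ge0 (a - b).
  by rewrite ler_norml => h1 h2; apply/andP; split; nra.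
move/le_trans; apply; rewrite ler_wpM2l ?addr_ge0//.
by nra.
Qed.

(** Expanding the square, the change of loss is 2 (y - mu) . H + q / (q + 1)^2.
    Stein's identity turns the expectation of the first term into that of twice
    the divergence, and the sum is
      - 2 r / (q + 1) + 5 q / (q + 1)^2 < 0  as soon as 2 r > 5. *)
Lemma shrink_strict_improvement mu :
  (\int[diag_normal d mu]_y (qform M (shrink y - mu))%:E <
   \int[diag_normal d mu]_y (qform M (y - mu))%:E)%E.
Proof.
have mid : measurable_fun setT (@id 'cV[R]_k) by exact: measurable_id.
have mKy : measurable_fun setT (fun y : 'cV[R]_k => K *m y) by exact: measurable_mulmx.
have mNy : measurable_fun setT (fun y : 'cV[R]_k => N *m y) by exact: measurable_mulmx.
have mGy : measurable_fun setT (fun y : 'cV[R]_k => G *m y) by exact: measurable_mulmx.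
have mq : measurable_fun setT q by exact: measurable_qform.
have mcoor X i : measurable_fun setT (fun y : 'cV[R]_k => (X *m y) i 0).
  by apply: measurable_coorT; exact: measurable_mulmx.
have mqi : measurable_fun setT (fun y => (q y + 1)^-1) by exact: measurable_inv_add1.
have mH i : measurable_fun setT (H i).
  apply: measurableT_comp => //; exact: measurable_funM.
have mH' i : measurable_fun setT (H' i).
  rewrite (_ : H' i = fun y => - (N i i * (q y + 1)^-1 -
    2 * (N *m y) i 0 * (G *m y) i 0 * ((q y + 1)^-1 * (q y + 1)^-1))); last first.
    by apply/funext => y; rewrite /H' expr2 invfM.
  apply: measurableT_comp => //; apply: measurable_funB; first exact: measurable_funM.
  apply: measurable_funM; last exact: measurable_funM.
  by apply: measurable_funM => //; exact: measurable_funM.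
have iSt i : (diag_normal d mu).-integrable setT
    (fun y => ((y i 0 - mu i 0) * H i y - d 0 i * H' i y)%:E).
  have [C C0 hC] := boundH i.
  apply: (@le_integrable _ _ _ _ _ measurableT _
    (fun y : 'cV[R]_k => C%:E * ((y i 0%R - mu i 0%R) ^+ 2)%:E + (C * (1 + d 0%R i))%:E)%E).
  - apply/measurable_EFinP; apply: measurable_funB; last exact: measurable_funM.
    by apply: measurable_funM => //; apply: measurable_funB => //; exact: measurable_coor.
  - move=> y _; rewrite -EFinM -EFinD /= lee_fin.
    have [h1 h2] := hC y; have u0 := sqr_ge0 (y i 0 - mu i 0).
    rewrite [leRHS]ger0_norm; last by rewrite addr_ge0// mulr_ge0// addr_ge0// ltW.
    apply: le_trans (ler_normB _ _) _; rewrite !normrM (gtr0_norm (d_gt0 i)).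
    have sq : `|y i 0 - mu i 0| ^+ 2 = (y i 0 - mu i 0) ^+ 2 by rewrite real_normK ?num_real.
    rewrite -sq; have := normr_ge0 (y i 0 - mu i 0); move: `|y i 0 - mu i 0| => u un.
    have e1 : u * `|H i y| <= u * C by rewrite ler_wpM2l.
    have e2 : d 0 i * `|H' i y| <= d 0 i * C by rewrite ler_wpM2l// ltW.
    have e3 : u <= 1 + u ^+ 2 by have := sqr_ge0 (u - 1); nra.
    have e4 := ler_wpM2l C0 e3; lra.
  - apply: integrableD => //; last exact: finite_measure_integrable_cst.
    by apply: integrableZl => //; exact: diag_normal_integrable_sqr.
have St i : (\int[diag_normal d mu]_y ((y i 0 - mu i 0) * H i y - d 0 i * H' i y)%:E = 0)%E.
  apply: diag_normal_stein => // v.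
  have [C C0 hC] := boundH i; exists C => x; have [h1 h2] := hC (upd v i x).
  by split; rewrite (le_trans h1, le_trans h2)// ler_peMr// lerDl.
pose Rr y := - ((2 * r%:R) / (q y + 1) - 5 * q y / (q y + 1) ^+ 2).
have mRr : measurable_fun setT Rr.
  rewrite (_ : Rr = fun y => - ((2 * r%:R) * (q y + 1)^-1 -
    5 * q y * ((q y + 1)^-1 * (q y + 1)^-1))); last first.
    by apply/funext => y; rewrite /Rr expr2 invfM.
  apply: measurableT_comp => //; apply: measurable_funB; first exact: measurable_funM.
  by apply: measurable_funM; exact: measurable_funM.
have r3 : 3 <= r%:R :> R by rewrite ler_nat.
have RrE y : Rr y = - ((2 * r%:R) * (q y + 1) - 5 * q y) / (q y + 1) ^+ 2.
  by rewrite /Rr; field; rewrite gt_eqF.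
have Rr_lt0 y : Rr y < 0.
  rewrite RrE mulNr oppr_lt0 divr_gt0 ?exprn_gt0// subr_gt0.
  by have := q_ge0 y; nra.
have Rr_ge y : - (2 * r%:R) <= Rr y.
  rewrite RrE ler_pdivlMr ?exprn_gt0//.
  by have := q_ge0 y; nra.
have iRr : (diag_normal d mu).-integrable setT (fun y => (Rr y)%:E).
  apply: (@le_integrable _ _ _ _ _ measurableT _ (fun y => (2 * r%:R)%:E)).
  - exact/measurable_EFinP.
  - move=> y _; rewrite lee_fin [leRHS]ger0_norm ?mulr_ge0// ltr0_norm//.
    by rewrite lerNl.
  - exact: finite_measure_integrable_cst.
have [iQ _] := diag_normal_qform d_gt0 mu M.
have E y : (qform M (shrink y - mu))%:E = ((qform M (y - mu))%:E +
    (\sum_i 2%:E * ((y i 0 - mu i 0) * H i y - d 0 i * H' i y)%:E) + (Rr y)%:E)%E.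
  under eq_bigr do rewrite -EFinM.
  rewrite sumEFin -!EFinD; congr (_%:E).
  have -> : shrink y - mu = (y - mu) + (- (q y + 1)^-1) *: (K *m y).
    by rewrite /shrink -/(q y) scaleNr addrAC.
  rewrite qformD ?psdM.1// qformZ -/(q y) dotZl -[LHS]addrA -[RHS]addrA; congr (_ + _).
  have -> : \sum_i 2 * ((y i 0 - mu i 0) * H i y - d 0 i * H' i y) =
     2 * (\sum_i (y i 0 - mu i 0) * H i y) - 2 * \sum_i d 0 i * H' i y.
    by rewrite -mulr_sumr sumrB mulrBr.
  rewrite div_sum.
  have -> : \sum_i (y i 0 - mu i 0) * H i y = - (q y + 1)^-1 * dot (K *m y) (M *m (y - mu)).
    rewrite dot_mul psdM.1 mulmxA dotC mulr_sumr; apply: eq_bigr => i _.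
    by rewrite !mxE /H !mxE; ring.
  rewrite /Rr; field; rewrite gt_eqF//.
under eq_integral do rewrite E.
have isum : (diag_normal d mu).-integrable setT
  (fun y => \sum_i 2%:E * ((y i 0 - mu i 0) * H i y - d 0 i * H' i y)%:E)%E.
  by apply: integrable_sum => // i _; exact: integrableZl.
rewrite integralD//; last exact: integrableD.
rewrite integralD// integral_sum//; last by move=> i; exact: integrableZl.
rewrite [X in (_ + X + _)%E]big1 ?adde0; last by move=> i _; rewrite integralZl// St mule0.
rewrite -[ltRHS]adde0 lteD2lE ?integrable_fin_num//.
have le0 : (\int[diag_normal d mu]_y (Rr y)%:E <= 0)%E.
  by apply: le0_integral => y; rewrite lee_fin ltW.
rewrite lt_neqAle le0 andbT; apply/eqP => int0.
have [y /eqP] : exists y, ((- 1)%:E * (Rr y)%:E = 0)%E.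
  apply: (prob_integral_eq0_ex (P := diag_normal d mu)).
  - by apply: measurable_funeM; exact/measurable_EFinP.
  - by move=> y; rewrite -EFinM lee_fin mulN1r oppr_ge0 ltW.
  - by rewrite integralZl// int0 mule0.
by rewrite -EFinM mulN1r eqe oppr_eq0 lt_eqF.
Qed.

End james_stein.

(** * Comparing an estimator with y *)
Section comparison.
Context {R : realType} {k n : nat}.
Variables (d : 'rV[R]_k) (A : 'M[R]_(n, k)) (delta : 'cV[R]_k -> 'cV[R]_k) (eps : R).
Hypotheses (d_gt0 : forall i, 0 < d 0 i) (mdelta : measurable_fun setT delta).
Hypotheses (eps_ge0 : 0 <= eps)
  (better : forall mu, (risk d (A^T *m A) mu delta + eps%:E <= risk d (A^T *m A) mu id)%E).

Let f y := A *m (delta y - y).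
Let T := \sum_i d 0 i * (A^T *m A) i i.

Let mid : measurable_fun setT (@id 'cV[R]_k). Proof. exact: measurable_id. Qed.

Lemma measurable_gap : measurable_fun setT (fun y => A *m (delta y - y)).
Proof. by apply: measurable_mulmx; exact: measurable_submx. Qed.

Let riskT mu : risk d (A^T *m A) mu id = T%:E.
Proof. by have [_] := diag_normal_qform d_gt0 mu (A^T *m A). Qed.

Let mdm mu : measurable_fun setT (fun y => A *m (delta y - mu)).
Proof. by apply: measurable_mulmx; exact: measurable_submx. Qed.

Let mym mu : measurable_fun setT (fun y : 'cV[R]_k => A *m (y - mu)).
Proof. by apply: measurable_mulmx; exact: measurable_submx. Qed.

Let split_err mu y : A *m (delta y - mu) = f y + A *m (y - mu).
Proof. by rewrite -mulmxDr addrA subrK. Qed.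

Let iw mu : (diag_normal d mu).-integrable setT
  (fun y => (dot (A *m (y - mu)) (A *m (y - mu)))%:E).
Proof.
have [iq _] := diag_normal_qform d_gt0 mu (A^T *m A).
by under eq_fun do rewrite -qform_gram.
Qed.

Let rE mu : risk d (A^T *m A) mu delta =
  (\int[diag_normal d mu]_y (dot (A *m (delta y - mu)) (A *m (delta y - mu)))%:E)%E.
Proof. by apply: eq_integral => y _; rewrite qform_gram. Qed.

Let rle mu : (risk d (A^T *m A) mu delta <= (T - eps)%:E)%E.
Proof. by rewrite EFinB leeBrDr// -(riskT mu); exact: better. Qed.

Let ie mu : (diag_normal d mu).-integrable setT
  (fun y => (dot (A *m (delta y - mu)) (A *m (delta y - mu)))%:E).
Proof.
apply/integrableP; split; first by apply/measurable_EFinP; exact: measurable_dot.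
under eq_integral do rewrite gee0_abs ?lee_fin ?dot_ge0//.
by rewrite -rE; apply: le_lt_trans (rle mu) _; rewrite ltry.
Qed.

(** f is the difference of the errors A (delta - mu) and A (y - mu), each of
    second moment at most T. *)
Lemma gap_second_moment mu :
  (\int[diag_normal d mu]_y (dot (f y) (f y))%:E <= (4 * T)%:E)%E.
Proof.
have mf := measurable_gap.
apply: (@le_trans _ _ (\int[diag_normal d mu]_y
  (2%:E * (dot (A *m (delta y - mu)) (A *m (delta y - mu)))%:E +
   2%:E * (dot (A *m (y - mu)) (A *m (y - mu)))%:E))%E).
  apply: ge0_le_integral => //.
  - by move=> y _; rewrite lee_fin dot_ge0.
  - by apply/measurable_EFinP; exact: measurable_dot.
  - by apply: emeasurable_funD; apply: measurable_funeM; apply/measurable_EFinP; exact: measurable_dot.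
  move=> y _; rewrite -!EFinM -EFinD lee_fin split_err.
  have := dot_ge0 (f y + A *m (y - mu) + A *m (y - mu)).
  rewrite !(dotDl, dotDr) (dotC (A *m _) (f y)); lra.
have ie' := ie mu; have iw' := iw mu.
rewrite integralD//; [|exact: integrableZl|exact: integrableZl].
rewrite !integralZl// -rE.
have [_ wT] := diag_normal_qform d_gt0 mu (A^T *m A).
under [X in (_ + _ * X)%E]eq_integral do rewrite -qform_gram.
rewrite wT -/T; apply: (@le_trans _ _ (2%:E * T%:E + 2%:E * T%:E)%E).
  rewrite leeD2r// lee_wpmul2l//; apply: le_trans (rle mu) _.
  by rewrite lee_fin gerBl.
by rewrite -!EFinM -EFinD lee_fin; lra.
Qed.

(** Expanding |f + A (y - mu)|^2 turns the comparison of risks into an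
    inequality in which delta occurs only through f. *)
Lemma gap_cross_term mu : (\int[diag_normal d mu]_y
  (dot (f y) (f y) + 2 * dot (f y) (A *m (y - mu)) + eps)%:E <= 0)%E.
Proof.
have E y : (dot (f y) (f y) + 2 * dot (f y) (A *m (y - mu)) + eps)%:E =
  ((dot (A *m (delta y - mu)) (A *m (delta y - mu)))%:E -
   (dot (A *m (y - mu)) (A *m (y - mu)))%:E + eps%:E)%E.
  rewrite -EFinB -EFinD; congr (_%:E); rewrite split_err.
  rewrite !(dotDl, dotDr) (dotC (A *m _) (f y)); ring.
under eq_integral do rewrite E.
have ie' := ie mu; have iw' := iw mu.
rewrite integralD//; last 2 first.
- exact: integrableB.
- exact: finite_measure_integrable_cst.
rewrite integralB// prob_integral_cst -rE.
have [_ wT] := diag_normal_qform d_gt0 mu (A^T *m A).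
under [X in (_ - X + _)%E]eq_integral do rewrite -qform_gram.
rewrite wT -/T; apply: (@le_trans _ _ ((T - eps)%:E - T%:E + eps%:E)%E).
  by rewrite leeD2r// leeD2r.
by rewrite -EFinB -EFinD lee_fin; lra.
Qed.

End comparison.

(** * Risks within the constrained class *)
Section risks.
Context {R : realType} {k m : nat}.
Variables (d : 'rV[R]_k) (Q : 'M[R]_k) (W : 'M[R]_(k, m)) (t : 'cV[R]_k -> 'cV[R]_m).
Hypotheses (d_gt0 : forall i, 0 < d 0 i) (posQ : posdefmx Q) (rankW : \rank W = m).
Hypotheses (mt : measurable_fun [set: 'cV[R]_k] t) (t2 : finite_second_moments d t).

Local Notation M := (projected_loss Q W).
Local Notation V := (invmx (W^T *m invmx Q *m W)).

Let psdV : psdmx V.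
Proof. exact/posdef_psd/posdef_inv/posdef_congr/rankW/posdef_inv. Qed.

Let psdM : psdmx M. Proof. exact: projected_loss_psd. Qed.

(** The error of the constrained estimator at mu is
    x + Q^-1 W V (s - W^T x) with x = delta y - mu and s = t y - W^T mu, so
    the decomposition of the loss applies pointwise. *)
Lemma risk_constrained mu delta : measurable_fun setT delta ->
  (risk d Q mu (constrained Q W t delta) = risk d M mu delta + risk2 d Q W t mu)%E.
Proof.
move=> mdelta; rewrite /risk /risk2 -ge0_integralD//; first last.
- apply/measurable_EFinP; apply: measurable_qform; exact: measurable_submx.
- by move=> y _; rewrite lee_fin psdV.2.
- apply/measurable_EFinP; apply: measurable_qform; exact: measurable_submx.
- by move=> y _; rewrite lee_fin psdM.2.
apply: eq_integral => y _; rewrite -EFinD -qform_constrained//; congr (qform Q _)%:E.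
rewrite /constrained addrAC; congr (_ + _ *m _).
by rewrite mulmxBr opprB addrA subrK.
Qed.

Lemma risk_lty n (X : 'M[R]_n) (g : 'cV[R]_k -> 'cV[R]_n) mu (c : 'cV[R]_n) :
  measurable_fun setT g -> (forall v, 0 <= qform X v) -> finite_second_moments d g ->
  (\int[diag_normal d mu]_y (qform X (g y - c))%:E < +oo)%E.
Proof.
move=> mg X0 g2; have [C C0 hC] := qform_le X.
have mgg : measurable_fun setT (fun y => (dot (g y) (g y))%:E).
  by apply/measurable_EFinP; exact: measurable_dot.
apply: (@le_lt_trans _ _ (\int[diag_normal d mu]_y ((C * 2)%:E * (dot (g y) (g y))%:E +
   (C * 2 * dot c c)%:E))%E).
  apply: ge0_le_integral => //.
  - by move=> y _; rewrite lee_fin.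
  - by apply/measurable_EFinP; apply: measurable_qform; exact: measurable_submx.
  - by apply: emeasurable_funD => //; exact: measurable_funeM.
  move=> y _; rewrite -EFinM -EFinD lee_fin; apply: le_trans (ler_norm _) _.
  apply: le_trans (hC _) _; rewrite -mulrA -mulrA -mulrDr ler_wpM2l//.
  by apply: le_trans (dotD_le _ _) _; rewrite dotNl dotNr opprK.
rewrite ge0_integralD//; first last.
- by move=> y _; rewrite lee_fin !mulr_ge0// dot_ge0.
- exact: measurable_funeM.
- by move=> y _; rewrite mule_ge0// lee_fin ?dot_ge0// mulr_ge0.
rewrite prob_integral_cst lte_add_pinfty ?ltry// ge0_integralZl//; first last.
- by rewrite lee_fin mulr_ge0.
- by move=> y _; rewrite lee_fin dot_ge0.
rewrite lte_mul_pinfty ?lee_fin ?mulr_ge0//.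
under eq_integral do rewrite dotE; exact: g2.
Qed.

Lemma risk2_fin mu : risk2 d Q W t mu \is a fin_num.
Proof.
rewrite ge0_fin_numE; last by apply: integral_ge0 => y _; rewrite lee_fin psdV.2.
exact: risk_lty psdV.2 t2.
Qed.

Lemma id_estimator : estimators d (@id 'cV[R]_k).
Proof.
split; first exact: measurable_id.
move=> mu; have [_ h] := diag_normal_qform d_gt0 mu 1%:M.
have mid : measurable_fun setT (@id 'cV[R]_k) by exact: measurable_id.
apply: (@le_lt_trans _ _ (\int[diag_normal d mu]_y (2%:E * (qform 1%:M (y - mu))%:E +
   (2 * dot mu mu)%:E))%E).
  apply: ge0_le_integral => //.
  - by move=> y _; rewrite lee_fin -dotE dot_ge0.
  - apply/measurable_EFinP; under eq_fun do rewrite -dotE; exact: measurable_dot.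
  - apply: emeasurable_funD => //; apply: measurable_funeM; apply/measurable_EFinP.
    by apply: measurable_qform; exact: measurable_submx.
  move=> y _; rewrite -EFinM -EFinD lee_fin -dotE qformE mul1mx.
  by rewrite -{1 2}(subrK mu y); exact: dotD_le.
rewrite ge0_integralD//; first last.
- by move=> y _; rewrite lee_fin mulr_ge0// dot_ge0.
- apply: measurable_funeM; apply/measurable_EFinP.
  by apply: measurable_qform; exact: measurable_submx.
- by move=> y _; rewrite mule_ge0// lee_fin qformE mul1mx dot_ge0.
rewrite prob_integral_cst lte_add_pinfty ?ltry// ge0_integralZl//; first last.
- by move=> y _; rewrite lee_fin qformE mul1mx dot_ge0.
- by apply/measurable_EFinP; apply: measurable_qform; exact: measurable_submx.
by rewrite h -EFinM ltry.
Qed.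

Lemma muCM_constrained : constrained_estimators d Q W t (muCM Q W t).
Proof. by exists id => //; exact: id_estimator. Qed.

Lemma shrink_estimator (X K : 'M[R]_k) : psdmx X -> estimators d (shrink X K).
Proof.
move=> [_ pX]; have [mid id2] := id_estimator.
have mKy : measurable_fun setT (fun y : 'cV[R]_k => K *m y) by exact: measurable_mulmx.
have ms : measurable_fun setT (shrink X K).
  apply: measurable_submx => //; apply: measurable_scalemx => //.
  by apply: measurable_inv_add1 => //; exact: measurable_qform.
split=> // mu; have [C C0 hC] := qform_le (K^T *m K).
apply: (@le_lt_trans _ _ (\int[diag_normal d mu]_y ((2 + 2 * C)%:E * (dot y y)%:E))%E).
  apply: ge0_le_integral => //.
  - by move=> y _; rewrite lee_fin -dotE dot_ge0.
  - by apply/measurable_EFinP; under eq_fun do rewrite -dotE; exact: measurable_dot.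
  - by apply: measurable_funeM; apply/measurable_EFinP; exact: measurable_dot.
  move=> y _; rewrite -EFinM lee_fin -dotE.
  apply: le_trans (dotD_le _ _) _; rewrite dotNl dotNr opprK dotZl dotZr (mulrDl 2) lerD2l -mulrA.
  rewrite ler_wpM2l//; apply: (@le_trans _ _ (dot (K *m y) (K *m y))); last first.
    by rewrite -qform_gram; apply: le_trans (ler_norm _) (hC y).
  have c1 : 1 <= qform X (K *m y) + 1 by rewrite lerDr.
  have c0 := lt_le_trans ltr01 c1.
  have i0 : 0 <= (qform X (K *m y) + 1)^-1 by rewrite invr_ge0 ltW.
  have i1 : (qform X (K *m y) + 1)^-1 <= 1 by rewrite invf_le1.
  by rewrite mulrA ler_piMl ?dot_ge0// mulr_ile1.
rewrite ge0_integralZl//; first last.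
- by rewrite lee_fin addr_ge0// mulr_ge0.
- by move=> y _; rewrite lee_fin dot_ge0.
- by apply/measurable_EFinP; exact: measurable_dot.
rewrite lte_mul_pinfty ?lee_fin ?addr_ge0 ?mulr_ge0//.
under eq_integral do rewrite dotE; exact: id2.
Qed.

Lemma risk_id mu : (risk d M mu id = (\sum_i d 0%R i * M i i)%:E)%E.
Proof. by have [_] := diag_normal_qform d_gt0 mu M. Qed.

Lemma muCM_risk mu : (risk d Q mu (muCM Q W t) =
  (\sum_i d 0%R i * M i i)%:E + risk2 d Q W t mu)%E.
Proof. by rewrite risk_constrained ?risk_id//; exact: measurable_id. Qed.

(** An estimator with smaller supremum risk would, R_2 being constant, improve on
    the constant risk of y by a fixed eps > 0 at every mu. *)
Lemma muCM_minimax :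
  (forall mu mu', risk2 d Q W t mu = risk2 d Q W t mu') ->
  minimax d Q (constrained_estimators d Q W t) (muCM Q W t).
Proof.
move=> r2; split; first exact: muCM_constrained.
apply/eqP; rewrite eq_le; apply/andP; split; last first.
  by apply: ereal_inf_lbound; exists (muCM Q W t) => //; exact: muCM_constrained.
apply: le_ereal_inf_tmp => _ [_ [delta [mdelta delta2] <-] <-].
rewrite leNgt; apply/negP => lt_sup.
pose b := sup_risk d Q (constrained Q W t delta).
pose T := \sum_i d 0 i * M i i.
have ub mu : (risk d M mu delta + risk2 d Q W t mu <= b)%E.
  by rewrite -(risk_constrained mu mdelta); apply: ereal_sup_ubound => /=; exists mu.
have supE : sup_risk d Q (muCM Q W t) = (T%:E + risk2 d Q W t 0)%E.
  rewrite /sup_risk (_ : [set _ | _ in _] = [set (T%:E + risk2 d Q W t 0)%E]) ?ereal_sup1//.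
  apply/seteqP; split => [_ [mu _ <-]|_ ->]; first by rewrite muCM_risk (r2 mu 0).
  by exists 0 => //; rewrite muCM_risk.
have rfin := risk2_fin 0.
have r1ge mu : (0 <= risk d M mu delta)%E.
  by apply: integral_ge0 => y _; rewrite lee_fin psdM.2.
have r2ge : (0 <= risk2 d Q W t 0)%E.
  by apply: integral_ge0 => y _; rewrite lee_fin psdV.2.
have bfin : b \is a fin_num.
  rewrite ge0_fin_numE; last by apply: le_trans (ub 0); exact: adde_ge0.
  by apply: lt_le_trans lt_sup _; rewrite leey.
have bT : fine b < T + fine (risk2 d Q W t 0).
  by rewrite -lte_fin EFinD !fineK// -supE.
pose eps := T + fine (risk2 d Q W t 0) - fine b.
have e0 : 0 < eps by rewrite subr_gt0.
have rM : (\rank M <= k - m)%N by rewrite rank_projected_loss.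
have [A MA] := psd_factor psdM rM.
have better mu : (risk d (A^T *m A) mu delta + eps%:E <= risk d (A^T *m A) mu id)%E.
  rewrite -MA risk_id -/T -leeBrDr// -EFinB.
  have -> : T - eps = fine b - fine (risk2 d Q W t 0) by rewrite /eps; ring.
  rewrite EFinB (fineK bfin) (fineK rfin) (leeBrDr _ _ rfin) (r2 0 mu).
  exact: ub.
have := uniform_gain_le0 d_gt0 (measurable_gap A mdelta)
  (fun th => gap_second_moment d_gt0 mdelta (ltW e0) better _) (ltW e0)
  (fun th => gap_cross_term d_gt0 mdelta better _).
by rewrite leNgt e0.
Qed.

(** A competitor at least as good everywhere has zero gap, hence the same risk
    as y at every mu. *)
Lemma muCM_admissible : (k - m <= 2)%N ->
  admissible d Q (constrained_estimators d Q W t) (muCM Q W t).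
Proof.
move=> km; split; first exact: muCM_constrained.
move=> [_ [delta [mdelta delta2] <-] [le [mu0 lt0]]].
have rM : (\rank M <= 2)%N by rewrite rank_projected_loss.
have [A MA] := psd_factor psdM rM.
have better mu : (risk d (A^T *m A) mu delta + 0%:E <= risk d (A^T *m A) mu id)%E.
  rewrite -MA adde0; have := le mu.
  rewrite muCM_risk (risk_constrained mu mdelta) -(risk_id mu) leeD2rE; last exact: risk2_fin.
  exact: id.
have gap0 := dominating_gap_eq0 d_gt0 (measurable_gap A mdelta)
  (fun th => gap_second_moment d_gt0 mdelta (lexx 0) better _)
  (fun th => gap_cross_term d_gt0 mdelta better _) mu0.
suff E : risk d M mu0 delta = risk d M mu0 id.
  by move: lt0; rewrite muCM_risk (risk_constrained mu0 mdelta) E risk_id ltxx.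
have mgap := measurable_gap A mdelta.
have mdot : measurable_fun setT (fun y => (dot (A *m (delta y - y)) (A *m (delta y - y)))%:E).
  by apply/measurable_EFinP; exact: measurable_dot.
have Z : (\int[diag_normal d mu0]_y `|(dot (A *m (delta y - y)) (A *m (delta y - y)))%:E| = 0)%E.
  by rewrite -gap0; apply: eq_integral => y _; rewrite gee0_abs ?lee_fin ?dot_ge0.
have mid : measurable_fun setT (@id 'cV[R]_k) by exact: measurable_id.
apply: ge0_ae_eq_integral => //.
- apply/measurable_EFinP; apply: measurable_qform; exact: measurable_submx.
- apply/measurable_EFinP; apply: measurable_qform; exact: measurable_submx.
- by move=> y _; rewrite lee_fin psdM.2.
- by move=> y _; rewrite lee_fin psdM.2.
have /iffLR/(_ Z) := ae_eq_integral_abs (diag_normal d mu0) measurableT mdot.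
apply: filterS => y /= /(_ I) [] /dot_eq0 h _; congr (_%:E).
rewrite MA !qform_gram; suff -> : A *m (delta y - mu0) = A *m (y - mu0) by [].
by apply/eqP; rewrite -subr_eq0 -mulmxBr opprB addrA subrK h.
Qed.

Lemma muCM_inadmissible : (3 <= k - m)%N ->
  inadmissible d Q (constrained_estimators d Q W t) (muCM Q W t).
Proof.
move=> km; split; first exact: muCM_constrained.
move=> [_]; apply.
have [K [KXK trXK]] := reflexive_inverse (diag_mx d *m M).
have uD : diag_mx d \in unitmx.
  by rewrite unitmxE det_diag unitfE; apply/prodf_neq0 => i _; rewrite gt_eqF.
have rX : \rank (diag_mx d *m M) = (k - m)%N.
  by rewrite (eqmxMfull _ _).1 ?row_full_unit// rank_projected_loss.
rewrite rX in trXK.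
have better := shrink_strict_improvement d_gt0 psdM KXK trXK km.
have es := shrink_estimator K psdM.
exists (constrained Q W t (shrink M K)); first by exists (shrink M K).
have lt mu : (risk d Q mu (constrained Q W t (shrink M K)) < risk d Q mu (muCM Q W t))%E.
  rewrite muCM_risk (risk_constrained mu es.1) -(risk_id mu) lteD2rE; last exact: risk2_fin.
  exact: better.
by split=> [mu|]; [exact/ltW|exists 0].
Qed.

End risks.

Theorem proposition3p2 (R : realType) (k m : nat) (d : 'rV[R]_k)
    (Q : 'M[R]_k) (W : 'M[R]_(k, m)) (t : 'cV[R]_k -> 'cV[R]_m)
    (d_gt0 : forall i, 0 < d 0 i)
    (posQ : posdefmx Q)
    (lt_mk : (m < k)%N)
    (rankW : \rank W = m)
    (mt : measurable_fun [set: 'cV[R]_k] t)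
    (t2 : finite_second_moments d t) :
  [/\ (forall mu mu' : 'cV[R]_k, risk2 d Q W t mu = risk2 d Q W t mu') ->
        minimax d Q (constrained_estimators d Q W t) (muCM Q W t),
      (k - m = 1 \/ k - m = 2)%N ->
        admissible d Q (constrained_estimators d Q W t) (muCM Q W t)
    & (3 <= k - m)%N ->
        inadmissible d Q (constrained_estimators d Q W t) (muCM Q W t)].
Proof.
split; [exact: muCM_minimax| |exact: muCM_inadmissible].
by move=> km; apply: muCM_admissible => //; case: km => ->.
Qed.
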